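(* Let $C\subset\mathbb{R}^2$ be a strictly convex body. Then for every finite set $S\subset\mathbb{R}^2$, \[f(C,2,S)\le |S|-\left\lceil\tfrac13(|S|-8)\right\rceil.\]
   Context: A convex body is a convex compact set with nonempty interior; it is strictly convex if its boundary contains no segment of positive length. A homothet of $C$ is $\lambda C+x$ with $\lambda>0$, $x\in\mathbb{R}^2$. $f(C,2,S)$ is the least number of homothets of $C$, each containing at most $2$ points of $S$, whose union covers $S$. *)

(* Defs.v *)
(* points of the plane are pairs in R * R,
   R : realType, with the product topology (= Euclidean topology). *)
From HB Require Import structures.
From mathcomp Require Import all_boot all_order all_algebra.
From mathcomp Require Import all_classical all_reals all_analysis.
Set Implicit Arguments. Unset Strict Implicit. Unset Printing Implicit Defensive.
Import Order.TTheory GRing.Theory Num.Theory numFieldNormedType.Exports.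
Local Open Scope classical_set_scope.
Local Open Scope ring_scope.

Section Plane.
Variable R : realType.
Local Notation pt := (R * R)%type.

Definition comb (x y : pt) (t : R) : pt :=
  ((1 - t) * x.1 + t * y.1, (1 - t) * x.2 + t * y.2).

Definition convex_set (C : set pt) : Prop :=
  forall x y t, C x -> C y -> 0 <= t <= 1 -> C (comb x y t).

Definition convex_body (C : set pt) : Prop :=
  [/\ convex_set C, compact C & interior C !=set0].

Definition boundary (C : set pt) : set pt := closure C `\` interior C.

Definition segment (x y : pt) : set pt :=
  [set comb x y t | t in [set t : R | 0 <= t <= 1]].

Definition strictly_convex_body (C : set pt) : Prop :=
  convex_body C /\ forall x y : pt, x != y -> ~ (segment x y `<=` boundary C).

Definition homothet (C : set pt) (lambda : R) (x : pt) : set pt :=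
  [set (lambda * c.1 + x.1, lambda * c.2 + x.2) | c in C].

(* number of points of the (duplicate-free) list S lying in H *)
Definition npts (H : set pt) (S : seq pt) : nat :=
  count (fun p => `[< H p >]) S.

Definition coverable (C : set pt) (k : nat) (S : seq pt) (n : nat) : Prop :=
  exists (lam : 'I_n -> R) (tr : 'I_n -> pt),
    [/\ forall i, 0 < lam i,
        forall i, (npts (homothet C (lam i) (tr i)) S <= k)%N
      & forall p, p \in S -> exists i, homothet C (lam i) (tr i) p].

(* f(C,k,S): least such n (0 by convention if no cover exists, which never
   happens for a convex body C) *)
Definition fcov (C : set pt) (k : nat) (S : seq pt) : nat :=
  match pselect (exists n, coverable C k S n) with
  | left h => ex_minn (P := fun n => `[< coverable C k S n >])
                (let: ex_intro n hn := h in ex_intro _ n (asboolT hn))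
  | right _ => 0%N
  end.
End Plane.

(* Main.v *)
(* Join two points of S when some homothet of C meets S in exactly these two.
   An involution pairing the points of S along such edges with as few fixed
   points as possible yields the cover, so by the Tutte-Berge formula it
   suffices that deleting a set A of points from this graph leaves at most
   2|A| + 8 components. Choose one point in each component, forming T. Every
   homothet containing two points of T contains a point of A, because shrinking
   a homothet that contains points of two components produces an edge between
   them. Four points Q placed far away in illuminating directions of C ensure
   that each t in T has, in every open half-plane bounded by a line through t,
   a neighbour in the Delaunay graph of T, A and Q, and by the above it lies in
   V = A + Q. Edges of this graph do not cross. Sweeping by a generic linear
   functional, t has two neighbours on the same side, and for the first vertex w
   of the wedge they span the edge directly above or directly below w issues
   from t, while w is in V. Hence |T| <= 2|V| = 2|A| + 8. *)
Require Import Defs.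
From HB Require Import structures.
From mathcomp Require Import all_boot all_order all_algebra.
From mathcomp Require Import all_classical all_reals all_analysis.
From mathcomp Require Import zify ring lra.
Import Order.TTheory GRing.Theory Num.Theory numFieldNormedType.Exports.
Local Open Scope classical_set_scope.
Local Open Scope ring_scope.

Set Implicit Arguments.
Unset Strict Implicit.
Unset Printing Implicit Defensive.

(** * Matchings and the Tutte-Berge inequality *)

Section Matching.
Variables (T : finType) (e : rel T).
Hypothesis e_sym : symmetric e.
Implicit Types (W A X U : {set T}) (m : {ffun T -> T}).

(* A matching of the subgraph induced by [W] is encoded as the involution that
   swaps matched vertices and fixes the others. *)
Definition matching W m : bool :=
  [forall x, [&& m (m x) == x, (m x == x) || e x (m x)
               & (x \notin W) ==> (m x == x)]].

Definition unmatched W m : {set T} := [set x in W | m x == x].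

Definition max_matching W m : Prop :=
  matching W m /\
  forall m', matching W m' -> (#|unmatched W m| <= #|unmatched W m'|)%N.

Lemma matchingP W m :
  reflect [/\ involutive m, forall x, m x != x -> e x (m x)
            & forall x, x \notin W -> m x = x] (matching W m).
Proof.
apply: (iffP forallP) => [h|[h1 h2 h3] x].
  split=> x; have /and3P[h1 h2 h3] := h x; first exact/eqP.
    by move=> /negPf hx; rewrite hx in h2.
  by move=> xW; apply/eqP/(implyP h3).
rewrite h1 eqxx /=; apply/andP; split; last by apply/implyP => /h3 ->.
by case: eqVneq => //= /h2.
Qed.

(** [m] maps the points ranked below their partner bijectively onto those ranked above, so counting
    the former and the fixed points twice counts [W] once and the fixed points once more. *)
Lemma card_matching_reps W m (r : T -> nat) : injective r -> matching W m ->
  ((#|[set x in W | r x <= r (m x)]%SET|.*2)%N = #|W| + #|unmatched W m|)%N.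
Proof.
move=> r_inj /matchingP[mK _ mW].
have mem_m x : (m x \in W) = (x \in W).
  apply/idP/idP; apply: contraLR => xW; first by rewrite mW.
  by have := mW _ xW; rewrite mK => ->.
set A := [set x in W | (r x < r (m x))%N].
set B := [set x in W | (r (m x) < r x)%N].
have AB : #|B| = #|A|.
  have <- : m @: A = B.
    apply/setP => x; apply/imsetP/idP => [[y]|].
      by rewrite !inE => /andP[yW yr] ->; rewrite mem_m yW mK.
    rewrite !inE => /andP[xW xr]; exists (m x); last by rewrite mK.
    by rewrite inE mem_m xW mK.
  by rewrite card_imset //; exact: inv_inj.
have reps : [set x in W | (r x <= r (m x))%N] = A :|: unmatched W m.
  apply/setP => x; rewrite !inE -andb_orr leq_eqVlt orbC (inj_eq r_inj).
  by rewrite eq_sym.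
have Wdec : W = (A :|: unmatched W m) :|: B.
  apply/setP => x; rewrite !inE -!andb_orr; case: (x \in W) => //=.
  by rewrite -(inj_eq r_inj); case: ltngtP.
have d1 : A :&: unmatched W m = finset.set0.
  apply/setP => x; rewrite !inE; case: (x \in W) => //=.
  by rewrite -(inj_eq r_inj); case: ltngtP.
have d2 : (A :|: unmatched W m) :&: B = finset.set0.
  apply/setP => x; rewrite !inE -andb_orr; case: (x \in W) => //=.
  by rewrite -(inj_eq r_inj); case: ltngtP.
have cW : #|W| = (#|A| + #|unmatched W m| + #|A|)%N.
  by rewrite {1}Wdec cardsU d2 cards0 subn0 cardsU d1 cards0 subn0 AB.
by rewrite reps cardsU d1 cards0 subn0 cW; lia.
Qed.

Lemma max_matching_argmax W m0 (P : {ffun T -> T} -> nat) :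
  max_matching W m0 ->
  forall Q : pred {ffun T -> T}, Q m0 ->
  exists m, [/\ max_matching W m, Q m &
    forall m', max_matching W m' -> Q m' -> (P m' <= P m)%N].
Proof.
move=> [m0M m0min] Q Qm0.
pose K := [pred m | [&& matching W m, #|unmatched W m| == #|unmatched W m0| & Q m]].
have Km0 : K m0 by rewrite /= m0M eqxx.
case: (arg_maxnP (P := K) P Km0) => m /and3P[mM /eqP mc Qm] mmax.
exists m; split => //; first by split=> // m' /m0min; rewrite mc.
move=> m' [m'M m'min] Qm'; apply: mmax; rewrite /= m'M Qm' andbT /=.
by rewrite eqn_leq m0min // m'min.
Qed.

Lemma max_matching_exists W : exists m, max_matching W m.
Proof.
have id_m : matching W [ffun x => x].
  by apply/matchingP; split=> x; rewrite !ffunE ?eqxx.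
case: (arg_minnP (P := matching W) (fun m => #|unmatched W m|) id_m) => m mM mmin.
by exists m; split.
Qed.

Section Rematch.
Variables (W : {set T}) (N : {ffun T -> T}) (x y : T).
Hypotheses (NM : matching W N) (xW : x \in W) (yW : y \in W).
Hypotheses (xy : x != y) (exy : e x y) (Nx : N x = x).

Definition rematch : {ffun T -> T} :=
  [ffun u => if u == x then y else if u == y then x
             else if u == N y then u else N u].

Lemma rematch_matching : matching W rematch.
Proof.
have [NK Ne NW] := matchingP _ _ NM.
have Ni := inv_inj NK.
have zx : N y != x by apply: contraNneq xy => zx; rewrite -(NK y) zx Nx.
apply/matchingP; split => u; rewrite !ffunE.
- case: (eqVneq u x) => [->|ux]; first by rewrite eq_sym (negPf xy) eqxx.
  case: (eqVneq u y) => [->|uy]; first by rewrite eqxx.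
  case: (eqVneq u (N y)) => [uz|uz].
    by rewrite (negPf ux) (negPf uy) uz eqxx.
  rewrite -[X in N u == X]Nx (inj_eq Ni) (negPf ux) -[X in N u == X]NK (inj_eq Ni).
  by rewrite (negPf uz) (inj_eq Ni) (negPf uy) NK.
- case: (eqVneq u x) => [->//|ux]; case: (eqVneq u y) => [->|uy].
    by rewrite e_sym.
  by case: (eqVneq u (N y)) => [//|_]; [rewrite eqxx | exact: Ne].
- move=> uW; case: (eqVneq u x) => [ux|_]; first by rewrite ux xW in uW.
  case: (eqVneq u y) => [uy|_]; first by rewrite uy yW in uW.
  by rewrite (NW _ uW) if_same.
Qed.

(** The former partner of [y] replaces [x] among the unmatched points, unless [y] was itself
    unmatched; then two unmatched points disappear. *)
Lemma rematch_card : #|unmatched W rematch| =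
  (#|unmatched W N| - (if N y == y then 2 else 0))%N.
Proof.
have [NK Ne NW] := matchingP _ _ NM.
have Ni := inv_inj NK.
have xyF := negPf xy; have yxF : (y == x) = false by rewrite eq_sym.
have zx : N y != x by apply: contraNneq xy => zx; rewrite -(NK y) zx Nx.
have zW : N y \in W by apply/negPn/negP => h; case/negP: (h); rewrite (Ni _ _ (NW _ h)).
have xU : x \in unmatched W N by rewrite inE xW Nx eqxx.
case: eqVneq => zy.
  have yU : y \in unmatched W N :\ x by rewrite !inE eq_sym xy yW zy eqxx.
  rewrite (cardsD1 x (unmatched W N)) xU (cardsD1 y (_ :\ x)) yU.
  rewrite addnA addKn; apply: eq_card => u; rewrite !inE !ffunE zy.
  case: (eqVneq u x) => [->|ux]; first by rewrite yxF xyF !andbF.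
  by case: (eqVneq u y) => [->|uy] //=; rewrite xyF ?andbF.
have zU : N y \notin unmatched W N by rewrite inE zW NK eq_sym.
have zyF := negPf zy; have yzF : (y == N y) = false by rewrite eq_sym.
have zxF := negPf zx; have xzF : (x == N y) = false by rewrite eq_sym.
rewrite subn0; have -> : unmatched W rematch = N y |: (unmatched W N :\ x).
  apply/setP => u; rewrite !inE !ffunE.
  case: (eqVneq u x) => [->|ux]; first by rewrite yxF xzF andbF.
  case: (eqVneq u y) => [->|uy]; first by rewrite xyF yzF zyF !andbF.
  by case: (eqVneq u (N y)) => [->|_] //=; rewrite zW eqxx.
by rewrite cardsU1 (cardsD1 x (unmatched W N)) xU !inE NK zxF zW yzF.
Qed.
End Rematch.

Lemma max_matching_edge W m x y : max_matching W m -> x \in W -> y \in W ->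
  x != y -> e x y -> m x = x -> m y != y.
Proof.
move=> [mM mmin] xW yW xy exy mx; apply/negP => my.
have := mmin _ (rematch_matching mM xW yW xy exy mx).
rewrite rematch_card // my.
have : (0 < #|unmatched W m|)%N by apply/card_gt0P; exists x; rewrite inE xW mx eqxx.
by lia.
Qed.

(* Gallai's lemma, stated as transitivity of the relation "no maximum matching
   misses both"; the exchange increases the agreement of [N] with [M]. *)
Lemma gallai W u w v M :
  (exists2 N, max_matching W N & N w = w) -> w \in W ->
  (forall N, max_matching W N -> N u = u -> N w != w) ->
  (forall N, max_matching W N -> N v = v -> N w != w) ->
  u \in W -> v \in W -> u != v ->
  max_matching W M -> M u = u -> M v != v.
Proof.
move=> [N0 N0max N0w] wW huw hvw uW vW uv Mmax Mu; apply/eqP => Mv.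
have [N [Nmax /eqP Nw Nagree]] := max_matching_argmax
  (fun N => #|[set x | M x == N x]%SET|) N0max (Q := fun N => N w == w)
  (introT eqP N0w).
have Nu : N u != u by apply/eqP => /(huw _ Nmax); rewrite Nw eqxx.
have Nv : N v != v by apply/eqP => /(hvw _ Nmax); rewrite Nw eqxx.
have [[MM Mmin] [NM Nmin]] := (Mmax, Nmax).
have cMN : #|unmatched W M| = #|unmatched W N|.
  by apply/eqP; rewrite eqn_leq Mmin // Nmin.
(* The unmatched sets have equal size and [u], [v] lie only in that of [M], so at least two points
   lie only in that of [N], one of them other than [w]. *)
set B := unmatched W N :\: unmatched W M.
have cB : (1 < #|B|)%N.
  have := cardsID (unmatched W M) (unmatched W N).
  have := cardsID (unmatched W N) (unmatched W M).
  rewrite finset.setIC cMN -/B => <- /eqP; rewrite eqn_add2l => /eqP ->.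
  rewrite (cardsD1 u) (cardsD1 v) !inE uW vW Mu Mv Nu Nv !eqxx eq_sym uv.
  by [].
have [x xB xw] : exists2 x, x \in B & x != w.
  move: cB; rewrite (cardsD1 w); have [->|] := posnP #|B :\ w|.
    by rewrite addn0; case: (w \in B).
  by case/card_gt0P => x; rewrite !inE => /andP[xw xB] _; exists x; rewrite // !inE.
move: xB; rewrite !inE => /andP[+ /andP[xW /eqP Nx]]; rewrite xW /= => Mx.
have [MK Me MW] := matchingP _ _ MM.
have [NK _ _] := matchingP _ _ NM.
pose y := M x.
have xy : x != y by rewrite eq_sym.
have yW : y \in W.
  by apply/negPn/negP => h; case/negP: (h); rewrite (inv_inj MK (MW _ h)).
have exy : e x y by exact: Me.
have Ny : N y != y by exact: (max_matching_edge Nmax xW yW xy).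
have yw : y != w by apply: contraNneq Ny => ->; exact/eqP.
have Rmax : max_matching W (rematch N x y).
  split; first exact: rematch_matching.
  by move=> m' /Nmin; rewrite rematch_card // (negPf Ny) subn0.
have Rw : rematch N x y w == w.
  by rewrite ffunE ![w == _]eq_sym (negPf xw) (negPf yw) Nw if_same.
(* The exchange agrees with [M] at [x] and [y]; the only other change is at [N y], where agreement
   of [N] with [M] would mean [N y = x]. *)
have := Nagree _ Rmax Rw; rewrite leqNgt => /negP; apply.
apply: proper_card; apply/properP; split.
  apply/fintype.subsetP => s; rewrite !inE ffunE => /eqP Ms.
  case: (eqVneq s x) => [->//|sx]; case: (eqVneq s y) => [->|sy].
    by rewrite /y MK.
  case: (eqVneq s (N y)) => [sz|_]; last exact/eqP.
  by case/eqP: sx; apply: (inv_inj MK); rewrite Ms sz NK.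
exists x; first by rewrite inE ffunE eqxx.
by rewrite inE Nx.
Qed.

(* The inequality of the Tutte-Berge formula that bounds the deficiency, with
   the components of the graph minus [A] represented by the points of [U]. *)
Lemma tutte_berge W : exists m A U,
  [/\ max_matching W m, A \subset W, U \subset W :\: A,
      (#|A| + #|unmatched W m| <= #|U|)%N &
      forall u v, u \in U -> v \in U -> u != v -> exists X,
        [/\ u \in X, v \notin X & forall x y, x \in W :\: A -> y \in W :\: A ->
            x \in X -> e x y -> y \in X]].
Proof.
have [n] := ubnP #|W|; elim: n W => // n IH W cW.
have [m mmax] := max_matching_exists W.
(* A point that no maximum matching misses is moved into [A]. *)
case: (pselect (exists2 v, v \in W & forall N, max_matching W N -> N v != v)).
  move=> [v vW hv].
  have [|m' [A [U [m'max AW UW cU sep]]]] := IH (W :\ v).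
    by move: cW; rewrite (cardsD1 v W) vW.
  exists m, (v |: A), U.
  have WD : W :\: (v |: A) = W :\ v :\: A by rewrite finset.setDDl.
  split=> //; rewrite ?WD //.
    apply/fintype.subsetP => x; rewrite in_setU1 => /orP[/eqP->//|].
    by move/(fintype.subsetP AW); rewrite inE => /andP[].
  have vA : v \notin A.
    by apply/negP => /(fintype.subsetP AW); rewrite !inE eqxx.
  rewrite cardsU1 vA; apply: leq_trans cU.
  have [mM mmin] := mmax; have [m'M m'min] := m'max.
  have [m'K m'e m'W] := matchingP _ _ m'M.
  have m'v : m' v = v by apply: m'W; rewrite !inE eqxx.
  have m'MW : matching W m'.
    apply/matchingP; split=> // x xW; apply: m'W.
    by rewrite !inE (negPf xW) andbF.
  have cm' : #|unmatched W m'| = #|unmatched (W :\ v) m'|.+1.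
    rewrite (cardsD1 v) !inE vW m'v eqxx add1n; congr _.+1.
    by apply: eq_card => x; rewrite !inE andbA.
  have lt : (#|unmatched W m| < #|unmatched W m'|)%N.
    rewrite ltnNge; apply/negP => le.
    have /hv : max_matching W m'.
      by split=> // N NM; apply: leq_trans le (mmin _ NM).
    by rewrite m'v eqxx.
  have ri : injective (fun x : T => nat_of_ord (enum_rank x)).
    by move=> a b /ord_inj /enum_rank_inj.
  (* Both deficiencies have the parity of [#|W|], so the strict inequality gains two: one pays for
     [v] in [A], the other for [v] being unmatched under [m']. *)
  have := card_matching_reps ri mM; have := card_matching_reps ri m'MW.
  by move: lt; rewrite cm' => {IH}; lia.
move=> hmiss.
have miss v : v \in W -> exists2 N, max_matching W N & N v = v.
  move=> vW; apply: contrapT => h; apply: hmiss; exists v => // N Nmax.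
  by apply/eqP => Nv; apply: h; exists N.
exists m, finset.set0, (unmatched W m); split=> //.
- by rewrite finset.sub0set.
- by rewrite finset.setD0; apply/fintype.subsetP => x; rewrite inE => /andP[].
- by rewrite cards0.
move=> u v; rewrite !inE => /andP[uW /eqP mu] /andP[vW /eqP mv] uv.
(* Here every point is missed by some maximum matching. The set consists of [u] and the points that
   no maximum matching misses together with [u]; [gallai] makes it closed under edges. *)
exists [set x in W | (x == u) || `[< forall N, max_matching W N -> N u = u -> N x != x >]].
split; first by rewrite !inE uW eqxx.
  rewrite !inE vW eq_sym (negPf uv) /=; apply/asboolPn => h.
  by have := h m mmax mu; rewrite mv eqxx.
move=> x y; rewrite finset.setD0 => _ yW; rewrite !inE => /andP[xW hx] exy.
rewrite yW /=; case: (eqVneq y u) => //= yu; apply/asboolP => N Nmax Nu.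
have [xyE|xy] := eqVneq x y.
  by move: hx; rewrite xyE (negPf yu) => /asboolP; apply.
case/orP: hx => [/eqP xu|/asboolP hx].
  by apply: (max_matching_edge Nmax xW yW xy exy); rewrite xu.
apply: (gallai (miss x xW) xW hx _ uW yW _ Nmax Nu); last by rewrite eq_sym.
move=> N' N'max N'y; apply: (max_matching_edge N'max yW xW _ _ N'y).
  by rewrite eq_sym.
by rewrite e_sym.
Qed.
End Matching.

(** * Straight-line bipartite plane graphs *)

Lemma seq_argmin (R : realDomainType) (I : eqType) (s : seq I) (K : I -> Prop)
    (f : I -> R) : (exists2 i, i \in s & K i) ->
  exists i, [/\ i \in s, K i & forall j, j \in s -> K j -> f i <= f j].
Proof.
elim: s => [[i]|a s IH [i]]; first by rewrite in_nil.
case: (pselect (exists2 i, i \in s & K i)) => [/IH[j [js Kj jmin]]|no].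
  move=> _ _; case: (pselect (K a /\ f a <= f j)) => [[Ka aj]|naj].
    exists a; split=> //; first exact: mem_head.
    move=> k; rewrite inE => /orP[/eqP->//|ks Kk].
    exact: le_trans aj (jmin _ ks Kk).
  exists j; split=> //; first by rewrite inE js orbT.
  move=> k; rewrite inE => /orP[/eqP->|] Kk; last exact: jmin.
  by case: (leP (f a) (f j)) => [h|/ltW//]; case: naj.
rewrite inE => /orP[/eqP->|si] Ki; last by case: no; exists i.
exists a; split=> //; first exact: mem_head.
by move=> k; rewrite inE => /orP[/eqP->//|ks Kk]; case: no; exists k.
Qed.

Section Sweep.
Variables (R : realFieldType) (P : choiceType) (T V : seq P).
Variable E : P -> P -> Prop.
Implicit Types (X Y : P -> R) (a b t u v w z : P).

(* [X], [Y] are the coordinates of a straight-line drawing, in which a point of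
   an edge is represented by its parameter. *)
Record bipartite_drawing X Y : Prop := BipartiteDrawing {
  edge_ends : forall t v, E t v -> t \in T /\ v \in V;
  sides_disjoint : forall t, t \in T -> t \notin V;
  X_inj : forall a b, a \in T ++ V -> b \in T ++ V -> X a = X b -> a = b;
  edges_noncrossing : forall t v t' v' s s', E t v -> E t' v' ->
    0 <= s <= 1 -> 0 <= s' <= 1 ->
    (1 - s) * X t + s * X v = (1 - s') * X t' + s' * X v' ->
    (1 - s) * Y t + s * Y v = (1 - s') * Y t' + s' * Y v' -> t = t' \/ v = v';
  edge_interior : forall t v a s, E t v -> a \in T ++ V -> 0 <= s <= 1 ->
    (1 - s) * X t + s * X v = X a -> (1 - s) * Y t + s * Y v = Y a ->
    a = t \/ a = v }.

Definition slope X Y t v : R := (Y v - Y t) / (X v - X t).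
Definition height X Y t v (x : R) : R := Y t + slope X Y t v * (x - X t).
Definition spans X t v (x : R) : Prop := X t <= x <= X v \/ X v <= x <= X t.
Definition sspans X t v (x : R) : Prop := X t < x < X v \/ X v < x < X t.

(** The first edge met by the upward vertical ray from [w] has [T]-end [t]. Strict spans leave out
    the edges that end at [w]. *)
Definition above X Y w t : Prop := exists v,
  [/\ E t v, sspans X t v (X w), Y w < height X Y t v (X w) &
   forall t' v', E t' v' -> sspans X t' v' (X w) ->
     Y w < height X Y t' v' (X w) ->
     height X Y t v (X w) <= height X Y t' v' (X w)].

(** Together with [drawing_oppX], this reflection reduces lower and left cases to upper and right
    ones. *)
Lemma drawing_oppY X Y : bipartite_drawing X Y ->
  bipartite_drawing X (fun z => - Y z).
Proof.
case=> h1 h2 h3 h4 h5; split => //.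
  move=> t v t' v' s s' e e' hs hs' hX hY; apply: (h4 t v t' v' s s') => //.
  by apply: oppr_inj; rewrite opprD -!mulrN hY opprD !mulrN.
move=> t v a s e aTV hs hX hY; apply: (h5 t v a s) => //.
by apply: oppr_inj; rewrite opprD -!mulrN.
Qed.

Lemma drawing_oppX X Y : bipartite_drawing X Y ->
  bipartite_drawing (fun z => - X z) Y.
Proof.
case=> h1 h2 h3 h4 h5; split => //.
- by move=> a b ha hb /oppr_inj; exact: h3.
- move=> t v t' v' s s' e e' hs hs' hX hY; apply: (h4 t v t' v' s s') => //.
  by apply: oppr_inj; rewrite opprD -!mulrN hX opprD !mulrN.
- move=> t v a s e aTV hs hX hY; apply: (h5 t v a s) => //.
  by apply: oppr_inj; rewrite opprD -!mulrN.
Qed.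

Lemma height_oppY X Y t v x :
  height X (fun z => - Y z) t v x = - height X Y t v x.
Proof. by rewrite /height /slope; ring. Qed.

Lemma slope_oppY X Y t v : slope X (fun z => - Y z) t v = - slope X Y t v.
Proof. by rewrite /slope; ring. Qed.

Lemma height_oppX X Y t v x :
  height (fun z => - X z) Y t v (- x) = height X Y t v x.
Proof.
rewrite /height /slope.
have -> : - X v - - X t = - (X v - X t) by ring.
by rewrite invrN; ring.
Qed.

Lemma sspans_oppX X t v x : sspans (fun z => - X z) t v (- x) <-> sspans X t v x.
Proof. by rewrite /sspans !ltrN2; split=> -[/andP[? ?]|/andP[? ?]]; [right|left|right|left]; apply/andP. Qed.

Lemma above_oppX X Y w t : above (fun z => - X z) Y w t -> above X Y w t.
Proof.
case=> v [e sp h m]; exists v; rewrite -!(height_oppX X); split=> //.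
  by apply/sspans_oppX.
by move=> t' v' e'; rewrite -!(height_oppX X) => /sspans_oppX; exact: m.
Qed.

Section Drawing.
Variables X Y : P -> R.
Hypothesis D : bipartite_drawing X Y.

Lemma edge_memT t v : E t v -> t \in T ++ V.
Proof. by case/(edge_ends D) => tT _; rewrite mem_cat tT. Qed.

Lemma edge_memV t v : E t v -> v \in T ++ V.
Proof. by case/(edge_ends D) => _ vV; rewrite mem_cat vV orbT. Qed.

Lemma edge_neq t v : E t v -> t != v.
Proof.
case/(edge_ends D) => tT vV; apply: contraNneq (sides_disjoint D tT) => ->.
exact: vV.
Qed.

Lemma edge_X_neq t v : E t v -> X v - X t != 0.
Proof.
move=> e; rewrite subr_eq0; apply: contra_neq (edge_neq e) => h.
by apply: (X_inj D) (edge_memT e) (edge_memV e) _.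
Qed.

Lemma height_left t v : height X Y t v (X t) = Y t.
Proof. by rewrite /height subrr mulr0 addr0. Qed.

Lemma height_right t v : E t v -> height X Y t v (X v) = Y v.
Proof. by move=> e; rewrite /height /slope; field; exact: edge_X_neq. Qed.

Lemma spans_param t v x : E t v -> spans X t v x -> exists s,
  [/\ 0 <= s <= 1, (1 - s) * X t + s * X v = x &
      (1 - s) * Y t + s * Y v = height X Y t v x].
Proof.
move=> e sp; exists ((x - X t) / (X v - X t)); have ne := edge_X_neq e.
split; [|by field|by rewrite /height /slope; field].
case: sp => /andP[h1 h2].
  have pos : 0 < X v - X t by rewrite lt_def ne subr_ge0 (le_trans h1).
  by rewrite ler_pdivlMr // ler_pdivrMr // mul0r mul1r lerD2r subr_ge0 h1.
have neg : X v - X t < 0 by rewrite lt_def eq_sym ne subr_le0 (le_trans h1).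
by rewrite ler_ndivlMr // mul0r ler_ndivrMr // mul1r lerD2r subr_le0 h1 h2.
Qed.

Lemma height_inj t v t' v' x : E t v -> E t' v' -> spans X t v x ->
  spans X t' v' x -> height X Y t v x = height X Y t' v' x -> t = t' \/ v = v'.
Proof.
move=> e e' /(spans_param e)[s [hs hX hY]] /(spans_param e')[s' [hs' hX' hY']] h.
by apply: (edges_noncrossing D e e' hs hs'); rewrite ?hX ?hY ?h.
Qed.

Lemma height_vertex t v a : E t v -> a \in T ++ V -> spans X t v (X a) ->
  height X Y t v (X a) = Y a -> a = t \/ a = v.
Proof.
move=> e aTV /(spans_param e)[s [hs hX hY]] h.
by apply: (edge_interior D e aTV hs); rewrite ?hX ?hY ?h.
Qed.

(** Two lowest edges over [w] have equal height there, so they share an end. If it is the [V]-end,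
    both lie on one line, and one of them contains the [T]-end of the other, which must then be its
    own. *)
Lemma above_unique w t u : above X Y w t -> above X Y w u -> t = u.
Proof.
case=> v [e sp h m] [v' [e' sp' h' m']].
have wk a b x : sspans X a b x -> spans X a b x.
  by case=> /andP[/ltW h1 /ltW h2]; [left|right]; rewrite h1 h2.
have heq : height X Y t v (X w) = height X Y u v' (X w).
  by apply/eqP; rewrite eq_le m // m'.
have [//|vv] := height_inj e e' (wk _ _ _ sp) (wk _ _ _ sp') heq.
move: e' sp' heq; rewrite -vv => e' sp' heq {vv}.
have sl : slope X Y t v = slope X Y u v.
  move: heq; have := height_right e; have := height_right e'.
  rewrite /height; set p := slope _ _ _ _; set q := slope _ _ _ _ => h1 h2 h3.
  have : (q - p) * (X v - X w) = 0 by lra.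
  move/eqP; rewrite mulf_eq0 !subr_eq0 => /orP[/eqP//|/eqP wv].
  by case: sp; rewrite wv ltxx ?andbF.
have hu : forall x, height X Y t v x = height X Y u v x.
  move=> x; have := height_right e; have := height_right e'.
  by rewrite /height sl; set q := slope _ _ _ _; lra.
have tv := edge_neq e; have uv := edge_neq e'.
have : spans X t v (X u) \/ spans X u v (X t).
  rewrite /spans.
  by case: sp => /andP[h1 h2]; case: sp' => /andP[h3 h4]; case: (leP (X t) (X u)) => h5;
    try (left; lra); try (right; lra); exfalso; lra.
case=> hs.
  have [//|uv'] := height_vertex e (edge_memT e') hs (etrans (hu _) (height_left _ _)).
  by rewrite uv' eqxx in uv.
have [//|tv'] := height_vertex e' (edge_memT e) hs (etrans (esym (hu _)) (height_left _ _)).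
by rewrite tv' eqxx in tv.
Qed.

(** The difference [d] of the heights is affine and changes sign, so the edges meet and share the
    end [b]. But then [d] vanishes at [X b], beyond [x1], and cannot also change sign before. *)
Lemma no_crossing t b t' v' x0 x1 : E t b -> E t' v' -> t' != t ->
  X t <= x0 -> x0 < x1 -> x1 <= X b -> spans X t' v' x0 -> spans X t' v' x1 ->
  (v' = b -> x1 < X b) -> height X Y t b x0 < height X Y t' v' x0 ->
  height X Y t' v' x1 <= height X Y t b x1 -> False.
Proof.
move=> e e' tt x0t x01 x1b sp0 sp1 vb h0 h1.
pose d x := height X Y t' v' x - height X Y t b x.
have dE x y : d x - d y = (slope X Y t' v' - slope X Y t b) * (x - y).
  by rewrite /d /height; ring.
set B := _ - _ in dE.
have d0 : 0 < d x0 by rewrite subr_gt0.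
have d1 : d x1 <= 0 by rewrite subr_le0.
have [vbE|vbN] := eqVneq v' b.
  have db : d (X b) = 0.
    by rewrite /d -vbE (height_right e') vbE (height_right e) subrr.
  have x1b' := vb vbE.
  have := dE x0 (X b); have := dE x1 (X b); rewrite db !subr0 => e1 e0.
  have B0 : B < 0 by nra.
  by nra.
have B0 : B < 0 by have := dE x0 x1; nra.
pose x := x0 - d x0 / B.
have dx : d x = 0.
  have := dE x x0; rewrite /x.
  have -> : B * (x0 - d x0 / B - x0) = - d x0 by field; rewrite lt_eqF.
  by lra.
have xx0 : x0 <= x.
  by rewrite /x lerDl oppr_ge0 mulr_ge0_le0 ?invr_le0 ?ltW.
have xx1 : x <= x1.
  have := dE x x1; rewrite dx => h.
  rewrite leNgt; apply/negP => h'.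
  have : B * (x - x1) < 0 by nra.
  by lra.
have sp : spans X t' v' x.
  by case: sp0 => /andP[a1 a2]; case: sp1 => /andP[a3 a4]; rewrite /spans;
     (try by left; lra); (try by right; lra).
have spb : spans X t b x by left; lra.
have hE : height X Y t' v' x = height X Y t b x by apply/eqP; rewrite -subr_eq0 -/(d x) dx.
have [h|h] := height_inj e' e sp spb hE.
  by rewrite h eqxx in tt.
by rewrite h eqxx in vbN.
Qed.
End Drawing.

Section Wedge.
Variables X Y : P -> R.
Hypothesis D : bipartite_drawing X Y.
Variables (t a b w : P).
Hypotheses (ta : E t a) (tb : E t b).
Hypotheses (wTV : w \in T ++ V) (tw : X t < X w) (wa : X w <= X a) (wb : X w <= X b).
Hypothesis w_first : forall z, z \in T ++ V -> X t < X z ->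
  slope X Y t a <= slope X Y t z <= slope X Y t b -> X w <= X z.

(* An edge entering the wedge from the left crosses neither side of it and has
   no endpoint in it before [w], so it starts at the apex. *)
Lemma wedge_edge t' v' l x1 : E t' v' -> X t < x1 -> x1 <= X w ->
  spans X t' v' x1 -> x1 != X v' -> l = t' \/ l = v' -> X l < x1 ->
  height X Y t a x1 <= height X Y t' v' x1 <= height X Y t b x1 -> t' = t.
Proof.
move=> e' tx1 x1w sp1 x1v lE lx1 /andP[ha hb].
apply/eqP/negPn/negP => tt.
(* Followed to the left from [x1], the edge reaches at [x0] its end [l] or the abscissa of the apex;
   [no_crossing] keeps it inside the wedge until then. *)
pose x0 := Num.max (X l) (X t).
have x01 : x0 < x1 by rewrite gt_max lx1.
have tx0 : X t <= x0 by rewrite le_max lexx orbT.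
have lx0 : X l <= x0 by rewrite le_max lexx.
have sp0 : spans X t' v' x0.
  by case: lE => lE; subst l; case: sp1 => /andP[a1 a2]; rewrite /spans;
    (try by left; lra); (try by right; lra).
have hb0 : height X Y t' v' x0 <= height X Y t b x0.
  rewrite leNgt; apply/negP => h; apply: (no_crossing D tb e' tt tx0 x01) h hb => //.
    exact: le_trans x1w wb.
  by move=> vb; rewrite lt_neqAle -{1}vb x1v (le_trans x1w).
have ha0 : height X Y t a x0 <= height X Y t' v' x0.
  rewrite leNgt; apply/negP => h.
  apply: (no_crossing (drawing_oppY D) ta e' tt tx0 x01); rewrite ?height_oppY ?ltrN2 ?lerN2 //.
    exact: le_trans x1w wa.
  by move=> va; rewrite lt_neqAle -{1}va x1v (le_trans x1w).
have [tl|lt] := ltP (X t) (X l).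
  have x0l : x0 = X l by rewrite /x0 max_l // ltW.
  have hl : height X Y t' v' (X l) = Y l.
    by case: lE => ->; [exact: height_left | exact: (height_right D e')].
  have lTV : l \in T ++ V.
    by case: lE => ->; [exact: (edge_memT D e') | exact: (edge_memV D e')].
  have pos : 0 < X l - X t by rewrite subr_gt0.
  have sl : slope X Y t a <= slope X Y t l <= slope X Y t b.
    move: ha0 hb0; rewrite x0l hl /height => ha0 hb0.
    rewrite {2 3}/slope ler_pdivlMr // ler_pdivrMr //; lra.
  by have := w_first lTV tl sl; lra.
have x0t : x0 = X t by rewrite /x0 max_r.
move: ha0 hb0; rewrite x0t !height_left => ha0 hb0.
have hE : height X Y t' v' (X t) = Y t by apply/eqP; rewrite eq_le ha0 hb0.
rewrite x0t in sp0.
have [h|h] := height_vertex D e' (edge_memT D ta) sp0 hE.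
  by rewrite h eqxx in tt.
have [tT _] := edge_ends D ta; have [_ vV] := edge_ends D e'.
by move: (sides_disjoint D tT); rewrite h vV.
Qed.

(** The edge from [t] to [b] passes strictly above [w], so a lowest edge above [w] exists; over [w]
    it runs between the sides of the wedge, so [wedge_edge] shows that it issues from [t]. *)
Lemma wedge_above : X w < X b -> slope X Y t a <= slope X Y t w < slope X Y t b ->
  above X Y w t.
Proof.
move=> wb' /andP[slaw slwb].
have hw : Y w = Y t + slope X Y t w * (X w - X t).
  by rewrite /slope; field; rewrite subr_eq0 gt_eqF.
have pos : 0 < X w - X t by rewrite subr_gt0.
have wub : Y w < height X Y t b (X w) by rewrite hw /height; nra.
have haw : height X Y t a (X w) <= Y w by rewrite hw /height; nra.
pose K (p : P * P) := [/\ E p.1 p.2, sspans X p.1 p.2 (X w) &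
  Y w < height X Y p.1 p.2 (X w)].
have [tT bV] := edge_ends D tb.
have [] := @seq_argmin R _ [seq (u, v) | u <- T, v <- V] K
  (fun p => height X Y p.1 p.2 (X w)).
  exists (t, b); first by apply/allpairsP; exists (t, b).
  by split=> //; left; rewrite tw.
move=> [t' v'] [_ [/= e' sp' h'] min'].
have leb : height X Y t' v' (X w) <= height X Y t b (X w).
  apply: (min' (t, b)); first by apply/allpairsP; exists (t, b).
  by split=> //; left; rewrite tw.
have tt : t' = t.
  have lel : height X Y t a (X w) <= height X Y t' v' (X w) <= height X Y t b (X w) by lra.
  case: sp' => /andP[s1 s2].
    apply: (wedge_edge (l := t') e' tw (lexx _) _ _ _ _ lel) => //.
    - by left; rewrite !ltW.
    - by rewrite lt_eqF.
    - by left.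
  apply: (wedge_edge (l := v') e' tw (lexx _) _ _ _ _ lel) => //.
  - by right; rewrite !ltW.
  - by rewrite gt_eqF.
  - by right.
rewrite tt in e' sp' h' min' leb.
exists v'; split=> // t2 v2 e2 sp2 h2.
apply: (min' (t2, v2)); last by split.
by have [? ?] := edge_ends D e2; apply/allpairsP; exists (t2, v2).
Qed.

(** An edge going left from [w] runs inside the wedge before [w], so it issues from the apex. This
    shows that the first vertex of the wedge is not in [T]. *)
Lemma wedge_left_edge v : E w v -> X v < X w ->
  slope X Y t a <= slope X Y t w <= slope X Y t b -> w = t.
Proof.
move=> e vw /andP[sa sb].
have hw : Y w = Y t + slope X Y t w * (X w - X t).
  by rewrite /slope; field; rewrite subr_eq0 gt_eqF.
have pos : 0 < X w - X t by rewrite subr_gt0.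
apply: (wedge_edge (l := v) e tw (lexx _) _ _ _ vw).
- by right; rewrite lexx ltW.
- by rewrite gt_eqF.
- by right.
- by rewrite height_left {1 2}hw /height; apply/andP; split; nra.
Qed.
End Wedge.

Lemma right_wedge_above X Y t a b : bipartite_drawing X Y ->
  (forall u, u \in T -> exists2 v, E u v & X v < X u) ->
  E t a -> E t b -> slope X Y t a < slope X Y t b -> X t < X a -> X t < X b ->
  exists2 w, w \in V & above X Y w t \/ above X (fun z => - Y z) w t.
Proof.
move=> D left_edge ta tb slab Xa Xb.
pose K z := X t < X z /\ slope X Y t a <= slope X Y t z <= slope X Y t b.
have [|w [wTV [tw slw] wmin]] := @seq_argmin R _ (T ++ V) K X.
  by exists a; [exact: (edge_memV D ta) | split=> //; rewrite lexx ltW].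
have wa : X w <= X a.
  by apply: wmin; [exact: (edge_memV D ta) | split=> //; rewrite lexx ltW].
have wb : X w <= X b.
  by apply: wmin; [exact: (edge_memV D tb) | split=> //; rewrite lexx ltW].
have w_first z : z \in T ++ V -> X t < X z ->
    slope X Y t a <= slope X Y t z <= slope X Y t b -> X w <= X z.
  by move=> zTV h1 h2; apply: wmin.
have wV : w \in V.
  move: (wTV); rewrite mem_cat => /orP[wT|//].
  have [v e vw] := left_edge _ wT.
  have h := wedge_left_edge D ta tb tw wa wb w_first e vw slw.
  by rewrite h ltxx in tw.
exists w => //; have /andP[slaw slwb] := slw.
have inj z : z \in T ++ V -> X w = X z -> w = z by exact: (X_inj D wTV).
have Dn := drawing_oppY D.
have w_first' z : z \in T ++ V -> X t < X z ->
    slope X (fun z => - Y z) t b <= slope X (fun z => - Y z) t z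
      <= slope X (fun z => - Y z) t a -> X w <= X z.
  by rewrite !slope_oppY !lerN2 => h1 h2 /andP[h3 h4]; apply: w_first; rewrite ?h3 ?h4.
have up : X w < X b -> slope X Y t w < slope X Y t b -> above X Y w t.
  by move=> h1 h2; apply: (wedge_above D ta tb tw wa wb w_first h1); rewrite slaw.
have down : X w < X a -> slope X Y t a < slope X Y t w -> above X (fun z => - Y z) w t.
  move=> h1 h2; apply: (wedge_above Dn tb ta tw wb wa w_first' h1).
  by rewrite !slope_oppY !lerN2 ltrN2 slwb.
(* If [w] is [a] or lies on the line of side [a], side [b] passes strictly above it; otherwise side
   [a] passes strictly below it. *)
have [waE|waN] := eqVneq (X w) (X a).
  have wE := inj _ (edge_memV D ta) waE.
  left; apply: up; last by rewrite wE.
  rewrite lt_neqAle wb andbT waE; apply: contraTneq slab => h.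
  by rewrite (X_inj D (edge_memV D ta) (edge_memV D tb) h) ltxx.
have wa' : X w < X a by rewrite lt_neqAle waN.
have [slwE|slwN] := eqVneq (slope X Y t a) (slope X Y t w); last first.
  by right; apply: down => //; rewrite lt_neqAle slwN.
left; apply: up; last by rewrite -slwE.
rewrite lt_neqAle wb andbT; apply: contraTneq slab => h.
by rewrite slwE (inj _ (edge_memV D tb) h) ltxx.
Qed.

(** Beyond [right_wedge_above] only equal slopes remain; then the nearer of [a] and [b] would lie
    inside the edge to the other. *)
Lemma right_pair_above X Y t a b : bipartite_drawing X Y ->
  (forall u, u \in T -> exists2 v, E u v & X v < X u) ->
  E t a -> E t b -> a != b -> X t < X a -> X t < X b ->
  exists2 w, w \in V & above X Y w t \/ above X (fun z => - Y z) w t.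
Proof.
move=> D left_edge ta tb ab Xa Xb.
case: (ltgtP (slope X Y t a) (slope X Y t b)) => sl.
- exact: right_wedge_above sl Xa Xb.
- exact: right_wedge_above sl Xb Xa.
have hE x : height X Y t a x = height X Y t b x by rewrite /height sl.
have aV := edge_memV D ta; have bV := edge_memV D tb.
case/eqP: ab; case: (leP (X a) (X b)) => h.
  have sp : spans X t b (X a) by left; rewrite h ltW.
  have [at'|//] := height_vertex D tb aV sp (etrans (esym (hE _)) (height_right D ta)).
  by rewrite at' ltxx in Xa.
have sp : spans X t a (X b) by left; rewrite !ltW.
have [bt|//] := height_vertex D ta bV sp (etrans (hE _) (height_right D tb)).
by rewrite bt ltxx in Xb.
Qed.

(** Of three edges at [t] two go to the same side, so [t] owns the edge directly above or directly
    below some [w] in [V]; each [w] has at most one owner above and one below. *)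
Lemma drawing_size X Y : bipartite_drawing X Y -> uniq T ->
  (forall u, u \in T -> exists2 v, E u v & X v < X u) ->
  (forall u, u \in T -> exists2 v, E u v & X u < X v) ->
  (forall u a b, E u a -> E u b -> exists v, [/\ E u v, v != a & v != b]) ->
  (size T <= 2 * size V)%N.
Proof.
move=> D Tuniq left_edge right_edge third_edge.
have hit t : t \in T -> exists2 w, w \in V & above X Y w t \/ above X (fun z => - Y z) w t.
  move=> tT; have [a ta aX] := left_edge _ tT; have [b tb bX] := right_edge _ tT.
  have [c [tc ca cb]] := third_edge _ _ _ ta tb.
  have := edge_X_neq D tc; rewrite subr_eq0 neq_lt => /orP[cX|cX]; last first.
    exact: right_pair_above D left_edge tc tb cb cX bX.
  have left_edge' u : u \in T -> exists2 v, E u v & - X v < - X u.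
    by case/right_edge => v e h; exists v; rewrite ?ltrN2.
  have [||w wV h] := right_pair_above (drawing_oppX D) left_edge' tc ta ca.
  - by rewrite ltrN2.
  - by rewrite ltrN2.
  by exists w => //; case: h => /above_oppX; [left|right].
have [->//|[t0 t0T]] : T = [::] \/ exists t0, t0 \in T.
  by case: T => [|t0 s]; [left | right; exists t0; exact: mem_head].
(* The default [t0] stands in where no edge passes over [w]; it suffices that every [t] occurs among
   the owners. *)
pose owner (Z : P -> R) w := xget t0 [set t | above X Z w t].
have ownerE Z : bipartite_drawing X Z -> forall w t, above X Z w t -> owner Z w = t.
  move=> DZ w t h; apply: (above_unique DZ _ h).
  by rewrite /owner; case: xgetP => [x _ //|/(_ t)].
have Dn := drawing_oppY D.
pose s := map (owner Y) V ++ map (owner (fun z => - Y z)) V.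
have -> : (2 * size V)%N = size s by rewrite size_cat !size_map mul2n addnn.
apply: uniq_leq_size => // t tT; rewrite mem_cat.
have [w wV [h|h]] := hit _ tT; apply/orP; [left|right]; apply/mapP; exists w => //.
  by rewrite (ownerE _ D _ _ h).
by rewrite (ownerE _ Dn _ _ h).
Qed.
End Sweep.

(** * Strictly convex bodies and their Delaunay graphs *)

Section ConvexBody.
Variable R : realType.
Local Notation pt := (R * R)%type.
Implicit Types (k l : R) (C : set pt) (x y z o c : pt) (S P : seq pt).

(** A homothet is represented by the map that carries it onto [C], so that [z] belongs to it when
    [C (aff al be z)]. A larger [al] means a smaller homothet. *)
Definition aff (al : R) (be z : pt) : pt := (al * z.1 + be.1, al * z.2 + be.2).

Lemma pt_eq x y : x.1 = y.1 -> x.2 = y.2 -> x = y.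
Proof. by case: x y => [? ?] [? ?] /= -> ->. Qed.

Lemma comb_aff o al be z k :
  comb o (aff al be z) k = aff (k * al) (comb o be k) z.
Proof. by apply: pt_eq; rewrite /=; ring. Qed.

Lemma aff_comb al be x y k :
  aff al be (comb x y k) = comb (aff al be x) (aff al be y) k.
Proof. by apply: pt_eq; rewrite /=; ring. Qed.

Lemma aff_inj al be x y : al != 0 -> aff al be x = aff al be y -> x = y.
Proof.
move=> al0 [/addIr h1 /addIr h2].
by apply: pt_eq; apply: (mulfI al0).
Qed.

Lemma combxx x k : comb x x k = x.
Proof. by apply: pt_eq; rewrite /=; ring. Qed.

Lemma comb0 x y : comb x y 0 = x.
Proof. by apply: pt_eq; rewrite /=; ring. Qed.

Lemma comb1 x y : comb x y 1 = y.
Proof. by apply: pt_eq; rewrite /=; ring. Qed.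

Lemma combC x y k : comb x y k = comb y x (1 - k).
Proof. by apply: pt_eq; rewrite /=; ring. Qed.

Lemma comb_comb x y k l : comb x (comb x y k) l = comb x y (l * k).
Proof. by apply: pt_eq; rewrite /=; ring. Qed.

Lemma comb_inj x y z k : k != 0 -> comb x y k = comb x z k -> y = z.
Proof.
move=> k0 [/addrI h1 /addrI h2].
by apply: pt_eq; apply: (mulfI k0).
Qed.

Lemma nbhs_square z (A : set pt) : nbhs z A -> exists2 d : R, 0 < d &
  forall y, `|y.1 - z.1| <= d -> `|y.2 - z.2| <= d -> A y.
Proof.
move=> /nbhs_ballP[e /= e0 he]; exists (e / 2); first by rewrite divr_gt0.
have le (r : R) : r <= e / 2 -> r < e by move=> h; apply: le_lt_trans h _; rewrite ltr_pdivrMr // ltr_pMr // ltr1n.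
by move=> y h1 h2; apply: he; split; rewrite /ball /= distrC; apply: le.
Qed.

Lemma nbhs_comb z x (A : set pt) : nbhs z A -> exists2 d : R, 0 < d &
  forall k, `|k| <= d -> A (comb z x k).
Proof.
move=> /nbhs_square[d d0 hd].
pose m := 1 + `|x.1 - z.1| + `|x.2 - z.2|.
have m0 : 0 < m by rewrite /m -addrA ltr_wpDr // addr_ge0.
exists (d / m); first by rewrite divr_gt0.
move=> k; rewrite ler_pdivlMr // => kd; apply: hd => /=.
  have -> : (1 - k) * z.1 + k * x.1 - z.1 = k * (x.1 - z.1) by ring.
  rewrite normrM; apply: le_trans kd; apply: ler_wpM2l => //.
  by rewrite /m; have := normr_ge0 (x.2 - z.2); lra.
have -> : (1 - k) * z.2 + k * x.2 - z.2 = k * (x.2 - z.2) by ring.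
rewrite normrM; apply: le_trans kd; apply: ler_wpM2l => //.
by rewrite /m; have := normr_ge0 (x.1 - z.1); lra.
Qed.

Lemma square_nbhs z (A : set pt) d : 0 < d ->
  (forall y, `|y.1 - z.1| < d -> `|y.2 - z.2| < d -> A y) -> nbhs z A.
Proof.
move=> d0 h; apply/nbhs_ballP; exists d => //= y [h1 h2]; apply: h.
  by move: h1; rewrite /ball /= distrC.
by move: h2; rewrite /ball /= distrC.
Qed.

Lemma small_all (I : eqType) (s : seq I) (K : I -> R -> Prop) :
  (forall i, i \in s -> exists2 d, 0 < d & forall e, 0 < e <= d -> K i e) ->
  exists2 d, 0 < d <= 1 & forall i e, i \in s -> 0 < e <= d -> K i e.
Proof.
elim: s => [|a s IH] h; first by exists 1; rewrite ?ltr01 ?lexx.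
have [d1 d10 h1] := h a (mem_head _ _).
have [|d2 /andP[d20 d21] h2] := IH; first by move=> i si; apply: h; rewrite inE si orbT.
exists (Num.min d1 d2); first by rewrite lt_min d10 d20 ge_min d21 orbT.
move=> i e; rewrite inE le_min => si /andP[e0 /andP[e1 e2]].
case/orP: si => [/eqP->|si]; first by apply: h1; rewrite e0.
by apply: h2 => //; rewrite e0.
Qed.

Lemma convex_comb C x y k : Defs.convex_set C -> C x -> C y -> 0 <= k <= 1 ->
  C (comb x y k).
Proof. by move=> h Cx Cy; exact: h. Qed.

(** The homothety of centre [y] and ratio [1 - k] maps a square around [x] inside [C] to a square
    around the new point. *)
Lemma interior_comb C x y k : Defs.convex_set C -> interior C x -> C y ->
  0 <= k < 1 -> interior C (comb x y k).
Proof.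
move=> Cconv /nbhs_square[d d0 hd] Cy /andP[k0 k1].
have k1' : 0 < 1 - k by rewrite subr_gt0.
apply: (square_nbhs (d := d * (1 - k))); first by rewrite mulr_gt0.
move=> z h1 h2.
have -> : z = comb (comb y z (1 - k)^-1) y k.
  by apply: pt_eq; rewrite /=; field; rewrite gt_eqF.
apply: (convex_comb Cconv) => //; last by rewrite k0 ltW.
apply: hd => /=; apply: ltW.
  have -> : (1 - (1 - k)^-1) * y.1 + (1 - k)^-1 * z.1 - x.1 =
    (z.1 - (comb x y k).1) / (1 - k) by rewrite /=; field; rewrite gt_eqF.
  by rewrite normrM normfV (gtr0_norm k1') ltr_pdivrMr.
have -> : (1 - (1 - k)^-1) * y.2 + (1 - k)^-1 * z.2 - x.2 =
  (z.2 - (comb x y k).2) / (1 - k) by rewrite /=; field; rewrite gt_eqF.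
by rewrite normrM normfV (gtr0_norm k1') ltr_pdivrMr.
Qed.

Variable C : set pt.
Hypothesis Cscb : strictly_convex_body C.

Let Cconv : Defs.convex_set C. Proof. by case: Cscb => -[]. Qed.
Let Ccompact : compact C. Proof. by case: Cscb => -[]. Qed.
Let Cint : interior C !=set0. Proof. by case: Cscb => -[]. Qed.

Lemma body_closed : closed C.
Proof. by apply: compact_closed Ccompact; exact: norm_hausdorff. Qed.

Lemma body_notin_nbhs z : ~ C z -> nbhs z (~` C).
Proof. by move=> nC; apply: open_nbhs_nbhs; split=> //; exact/closed_openC/body_closed. Qed.

(** Strict convexity puts one point of the segment in the interior; any other inner point lies
    between it and an end, where [interior_comb] applies. *)
Lemma comb_interior x y k : C x -> C y -> x != y -> 0 < k < 1 ->
  interior C (comb x y k).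
Proof.
move=> Cx Cy xy /andP[k0 k1].
have [l /andP[l0 l1] zint] : exists2 l, 0 <= l <= 1 & interior C (comb x y l).
  apply: contrapT => h; apply: (Cscb.2 x y xy) => _ [l hl <-]; split.
    by apply: subset_closure; case/andP: hl => ? ?; apply: (convex_comb Cconv) => //; apply/andP.
  by move=> hint; apply: h; exists l.
case: (ltgtP k l) => [kl|lk|->//].
  have l0' : 0 < l by lra.
  have -> : comb x y k = comb (comb x y l) x (1 - k / l).
    by apply: pt_eq; rewrite /=; field; rewrite gt_eqF.
  apply: interior_comb => //; rewrite subr_ge0 ler_pdivrMr // mul1r ltW //=.
  by rewrite ltrBlDr ltrDl divr_gt0.
have l1' : 0 < 1 - l by lra.
have -> : comb x y k = comb (comb x y l) y ((k - l) / (1 - l)).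
  by apply: pt_eq; rewrite /=; field; rewrite gt_eqF.
apply: interior_comb => //; rewrite divr_ge0 ?subr_ge0 ?(ltW lk) //=.
by rewrite ltr_pdivrMr // mul1r ltrD2r.
Qed.

Lemma linear_max (f1 f2 : R) : exists2 c, C c &
  forall z, C z -> f1 * z.1 + f2 * z.2 <= f1 * c.1 + f2 * c.2.
Proof.
have [ o /interior_subset Co] := Cint.
have fc : {within C, continuous (fun z : pt => f1 * z.1 + f2 * z.2)}.
  apply: continuous_subspaceT => z.
  by apply: cvgD; apply: cvgM; [exact: cvg_cst|exact: cvg_fst|exact: cvg_cst|exact: cvg_snd].
have [c cC cmax] := compact_EVT_max (ex_intro _ o Co) Ccompact fc.
exists c; first by rewrite inE in cC.
by move=> z Cz; apply: cmax; rewrite inE.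
Qed.

Lemma ray_max y z : C z -> y != z -> exists v, [/\ 1 <= v, C (comb y z v) &
  forall u, C (comb y z u) -> u <= v].
Proof.
move=> Cz yz; pose d : pt := (z.1 - y.1, z.2 - y.2).
have dd : 0 < d.1 ^+ 2 + d.2 ^+ 2.
  rewrite lt_def addr_ge0 ?sqr_ge0 // andbT paddr_eq0 ?sqr_ge0 // !sqrf_eq0.
  rewrite !subr_eq0; apply: contra yz => /andP[/eqP h1 /eqP h2].
  by apply/eqP/pt_eq.
(* [g] vanishes exactly on the line through [y] and [z], and [f] measures the position along it. *)
pose g (w : pt) := d.1 * (w.2 - y.2) - d.2 * (w.1 - y.1).
pose f (w : pt) := d.1 * w.1 + d.2 * w.2.
have fcont : continuous f.
  move=> w.
  by apply: cvgD; apply: cvgM; [exact: cvg_cst|exact: cvg_fst|exact: cvg_cst|exact: cvg_snd].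
have gcont : continuous g.
  move=> w; apply: cvgB; apply: cvgM; [exact: cvg_cst| |exact: cvg_cst|].
    by apply: cvgB; [exact: cvg_snd|exact: cvg_cst].
  by apply: cvgB; [exact: cvg_fst|exact: cvg_cst].
have Lclosed : closed (g @^-1` [set 0]).
  by apply: closed_comp => [w _|]; [exact: gcont | exact: closed_eq].
have gE k : g (comb y z k) = 0 by rewrite /g /d /=; ring.
have fE k : f (comb y z k) = f y + k * (d.1 ^+ 2 + d.2 ^+ 2) by rewrite /f /d /=; ring.
have Dz : (C `&` g @^-1` [set 0]) z by split=> //=; rewrite -(comb1 y z) gE.
have [w] := compact_EVT_max (ex_intro _ z Dz) (compact_closedI Ccompact Lclosed)
  (continuous_subspaceT fcont).
rewrite inE => -[Cw gw] wmax.
pose v := (f w - f y) / (d.1 ^+ 2 + d.2 ^+ 2).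
have wE : w = comb y z v.
  have N0 := lt0r_neq0 dd.
  have e1 : w.1 - y.1 = v * d.1.
    apply: (mulIf N0); apply/eqP; rewrite -subr_eq0; apply/eqP.
    transitivity (- d.2 * g w); last by rewrite gw mulr0.
    by rewrite /v /f /g; field.
  have e2 : w.2 - y.2 = v * d.2.
    apply: (mulIf N0); apply/eqP; rewrite -subr_eq0; apply/eqP.
    transitivity (d.1 * g w); last by rewrite gw mulr0.
    by rewrite /v /f /g; field.
  by apply: pt_eq; rewrite /=; move: e1 e2; rewrite /d /=; lra.
have maxv u : C (comb y z u) -> u <= v.
  move=> Cu; have := wmax (comb y z u); rewrite inE wE !fE.
  have D0 : (C `&` g @^-1` [set 0]) (comb y z u) by split=> //=; rewrite gE.
  by move=> /(_ D0); rewrite lerD2l ler_pM2r.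
exists v; split=> //; last by rewrite -wE.
by apply: maxv; rewrite comb1.
Qed.

Lemma ray_exit S P al be t s : {subset P <= S} ->
  al != 0 -> interior C (aff al be t) ->
  s \in P -> s != t -> C (aff al be s) ->
  exists al' be' s0, [/\ 0 < al' / al, s0 \in P, s0 != t &
   [/\ C (aff al' be' t), C (aff al' be' s0),
   forall u, u \in S -> C (aff al' be' u) -> C (aff al be u) &
   forall u, u \in P -> C (aff al' be' u) -> u = t \/ u = s0]].
Proof.
move=> PS al0 tint sP st Cs.
pose y u := aff al be u.
have Ct : C (y t) by exact: interior_subset.
have yneq u : u != t -> y t != y u.
  by apply: contra_neq => /(aff_inj al0).
(* [nu u] is the largest factor by which the image of [u] can be pushed away from that of [t] within
   [C]; a maximiser [s0] is a last point kept when the homothet shrinks about [t]. *)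
pose nu u := xget 0 [set v : R | [/\ 1 <= v, C (comb (y t) (y u) v) &
  forall w, C (comb (y t) (y u) w) -> w <= v]].
have nuP u : u != t -> C (y u) -> [/\ 1 <= nu u, C (comb (y t) (y u) (nu u)) &
    forall w, C (comb (y t) (y u) w) -> w <= nu u].
  move=> ut Cu; have [v hv] := ray_max Cu (yneq _ ut).
  by rewrite /nu; case: xgetP => [? _ //|/(_ v)].
have [|s0 [s0P [s0t Cs0] s0max]] := @seq_argmin R _ P
  (fun u => u != t /\ C (y u)) (fun u => - nu u); first by exists s.
have [v1 Cv vmax] := nuP _ s0t Cs0.
set v := nu s0 in v1 Cv vmax s0max.
have v0 : 0 < v by lra.
pose z u := comb (y t) (y u) v.
(* An interior image could be pushed slightly further, against the maximality of [v]. *)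
have znint u : u \in P -> u != t -> ~ interior C (z u).
  move=> uP ut /(nbhs_comb (comb (y t) (y u) (v + 1)))[d d0 hd].
  have Cd : C (comb (y t) (y u) (v + d)).
    have -> : comb (y t) (y u) (v + d) = comb (z u) (comb (y t) (y u) (v + 1)) d.
      by apply: pt_eq; rewrite /=; ring.
    by apply: hd; rewrite ger0_norm // ltW.
  have Cu : C (y u).
    have -> : y u = comb (y t) (comb (y t) (y u) (v + d)) (v + d)^-1.
      by rewrite comb_comb mulVf ?comb1 //; rewrite gt_eqF // addr_gt0.
    by apply: (convex_comb Cconv) => //; rewrite invr_ge0 invf_le1; lra.
  have [_ _ umax] := nuP _ ut Cu.
  have := s0max _ uP (conj ut Cu); have := umax _ Cd; lra.
have zC u : C (z u) -> C (y u).
  move=> Cz; have -> : y u = comb (y t) (z u) v^-1.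
    by rewrite comb_comb mulVf ?comb1 // gt_eqF.
  by apply: (convex_comb Cconv) => //; rewrite invr_ge0 invf_le1 //; lra.
(* Since the image of [t] is interior, a slight further dilation about the image of [s0] keeps it in
   [C]. *)
have [d d0 hd] := nbhs_comb (z s0) tint.
pose h u := comb (z s0) (z u) (1 + d).
have hE u : h u = aff ((1 + d) * (v * al)) (comb (z s0) (comb (y t) be v) (1 + d)) u.
  by rewrite /h {2}/z comb_aff comb_aff.
exists ((1 + d) * (v * al)), (comb (z s0) (comb (y t) be v) (1 + d)), s0.
have d1 : 0 <= (1 + d)^-1 <= 1 by rewrite invr_ge0 invf_le1; lra.
have hz u : z u = comb (z s0) (h u) (1 + d)^-1.
  by rewrite comb_comb mulVf ?comb1 // gt_eqF // addr_gt0.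
split=> //.
  by rewrite !mulrA mulfK // mulr_gt0 // addr_gt0.
split.
- rewrite -hE /h combC; have -> : z t = y t by rewrite /z combxx.
  by apply: hd; rewrite opprD addNKr normrN gtr0_norm.
- by rewrite -hE /h combxx.
- by move=> u uS; rewrite -hE => Ch; apply: zC; rewrite hz; apply: (convex_comb Cconv).
move=> u uP; rewrite -hE => Ch.
have [->|ut] := eqVneq u t; first by left.
have [->|us0] := eqVneq u s0; first by right.
(* A surviving third point would have its image [z u] strictly between two points of [C], hence in
   the interior. *)
case: (znint _ uP ut); rewrite hz; apply: comb_interior => //.
  apply: contra_neq us0 => /(congr1 (fun w => comb (z s0) w (1 + d)^-1)).
  rewrite combxx -hz => /(comb_inj (lt0r_neq0 v0)) /(aff_inj al0) //.
by rewrite invr_gt0 invf_lt1; lra.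
Qed.

(* Shrinking a homothet that contains [t] first about [t] and then slightly
   about a point reached last isolates a single further point of [P]; the
   homothet is enlarged beforehand to make [t] interior. *)
Lemma shrink_homothet S P al be t s : {subset P <= S} -> t \in S ->
  0 < al -> C (aff al be t) -> s \in P -> s != t -> C (aff al be s) ->
  exists al' be' s0, [/\ 0 < al', s0 \in P, s0 != t &
   [/\ C (aff al' be' t), C (aff al' be' s0),
   forall u, u \in S -> C (aff al' be' u) -> C (aff al be u) &
   forall u, u \in P -> C (aff al' be' u) -> u = t \/ u = s0]].
Proof.
move=> PS tS al0 Ct sP st Cs.
have [ o oint] := Cint; have Co : C o by exact: interior_subset.
(* Pulling images towards [o] enlarges the homothet; as [C] is closed, a small pull captures no new
   point of [S]. *)
pose K u (e : R) := C (comb (aff al be u) o e) -> C (aff al be u).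
have [|d /andP[d0 d1] hd] := @small_all _ S K.
  move=> u uS; have [Cu|nCu] := pselect (C (aff al be u)).
    by exists 1; rewrite // /K.
  have [d d0 hd] := nbhs_comb o (body_notin_nbhs nCu).
  exists d => // e /andP[e0 ed] Ce; exfalso; apply: hd Ce.
  by rewrite gtr0_norm.
(* Halving [d <= 1] keeps the ratio [1 - k] positive. *)
pose k := d / 2.
have k0 : 0 < k < 1 by rewrite /k; lra.
have kE u : comb (aff al be u) o k = aff ((1 - k) * al) (comb o be (1 - k)) u.
  by rewrite combC comb_aff.
have al1 : 0 < (1 - k) * al by rewrite mulr_gt0 //; lra.
have tint : interior C (aff ((1 - k) * al) (comb o be (1 - k)) t).
  by rewrite -kE combC; apply: interior_comb => //; lra.
have Cs' : C (aff ((1 - k) * al) (comb o be (1 - k)) s).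
  by rewrite -kE; apply: (convex_comb Cconv) => //; lra.
have [al' [be' [s0 [h1 h2 h3 [h4 h5 h6 h7]]]]] :=
  ray_exit PS (lt0r_neq0 al1) tint sP st Cs'.
exists al', be', s0; split=> //.
  by move: h1; rewrite pmulr_lgt0 // invr_gt0.
split=> // u uS /(h6 _ uS); rewrite -kE; apply: (hd _ _ uS).
by rewrite /k; lra.
Qed.

Definition delaunay S u v : Prop := exists al be,
  [/\ 0 < al, C (aff al be u), C (aff al be v) &
   forall s, s \in S -> C (aff al be s) -> s = u \/ s = v].

Lemma delaunay_neighbor S al be t s : t \in S -> s \in S -> s != t ->
  0 < al -> C (aff al be t) -> C (aff al be s) ->
  exists v, [/\ v \in S, v != t, C (aff al be v) & delaunay S t v].
Proof.
move=> tS sS st al0 Ct Cs.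
have [al' [be' [v [h1 h2 h3 [h4 h5 h6 h7]]]]] :=
  @shrink_homothet S S al be t s (fun _ => id) tS al0 Ct sS st Cs.
by exists v; split=> //; [exact: h6 | exists al', be'; split].
Qed.

(** Shrinking about [t2] leaves a single point [s1] of [X] in the homothet; shrinking again about
    [s1] leaves a single point [s2] outside [X]. *)
Lemma delaunay_bichromatic S (X : pred pt) al be t1 t2 : t1 \in S -> t2 \in S ->
  X t1 -> ~~ X t2 -> 0 < al -> C (aff al be t1) -> C (aff al be t2) ->
  exists s1 s2, [/\ s1 \in S, s2 \in S, X s1, ~~ X s2 &
    [/\ C (aff al be s1), C (aff al be s2) & delaunay S s1 s2]].
Proof.
move=> t1S t2S X1 X2 al0 C1 C2.
have sub (Z : pred pt) : {subset [seq u <- S | Z u] <= S}.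
  by move=> u; rewrite mem_filter => /andP[].
have t12 : t1 != t2 by apply: contraNneq X2 => <-.
have t1P : t1 \in [seq u <- S | X u] by rewrite mem_filter X1.
have [a1 [b1 [s1 [h1 h2 h3 [h4 h5 h6 h7]]]]] :=
  shrink_homothet (sub X) t2S al0 C2 t1P t12 C1.
move: h2; rewrite mem_filter => /andP[Xs1 s1S].
have t2P : t2 \in [seq u <- S | ~~ X u] by rewrite mem_filter X2.
rewrite eq_sym in h3.
have [a2 [b2 [s2 [g1 g2 g3 [g4 g5 g6 g7]]]]] :=
  shrink_homothet (sub (fun u => ~~ X u)) s1S h1 h5 t2P h3 h4.
move: g2; rewrite mem_filter => /andP[Xs2 s2S].
exists s1, s2; split=> //; split; [exact: h6 | by apply/h6/g6 |].
exists a2, b2; split=> // u uS Cu.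
have [Xu|Xu] := boolP (X u); last by apply: g7; rewrite // mem_filter Xu.
have uP : u \in [seq u <- S | X u] by rewrite mem_filter Xu.
have [ut|->] := h7 u uP (g6 _ uS Cu); last by left.
by move: X2; rewrite -ut Xu.
Qed.
End ConvexBody.

(** * Segments spanned by two homothets do not cross *)

Section Planarity.
Variable R : realType.
Local Notation pt := (R * R)%type.
Implicit Types (C : set pt) (x y z p q r s : pt).

Definition cross (x y : pt) : R := x.1 * y.2 - x.2 * y.1.
Definition vec (x y : pt) : pt := (y.1 - x.1, y.2 - x.2).

Lemma convex_comb3 C x y z (a b : R) : Defs.convex_set C -> C x -> C y -> C z ->
  0 <= a -> 0 <= b -> a + b <= 1 ->
  C (a * x.1 + b * y.1 + (1 - a - b) * z.1,
     a * x.2 + b * y.2 + (1 - a - b) * z.2).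
Proof.
move=> Cconv Cx Cy Cz a0 b0 ab; have [ab0|ab0] := eqVneq (a + b) 0.
  have -> : a = 0 by lra.
  have -> : b = 0 by lra.
  have -> // : (0 * x.1 + 0 * y.1 + (1 - 0 - 0) * z.1,
    0 * x.2 + 0 * y.2 + (1 - 0 - 0) * z.2) = z by apply: pt_eq; rewrite /=; ring.
have abp : 0 < a + b by rewrite lt_def ab0 addr_ge0.
set w := (_, _).
have -> : w = comb z (comb x y (b / (a + b))) (a + b).
  by apply: pt_eq; rewrite /=; field.
apply: (convex_comb Cconv) => //; last by rewrite ltW.
apply: (convex_comb Cconv) => //; rewrite divr_ge0 //=; last exact: ltW.
by rewrite ler_pdivrMr // mul1r lerDr.
Qed.

Variable C : set pt.
Hypothesis Cconv : Defs.convex_set C.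

(* [H1] and [H2] are the homothets whose images under [u] and [v] are [C], and
   [d] is the scaled displacement of [z] under the homothety from [H1] to [H2].
   Under the sign conditions, either [p] is a convex combination of its image,
   [r] and [z], hence in [H2], or [r] is one of its preimage, [p] and [z], hence
   in [H1]. *)
Lemma crossing_sign (al1 al2 : R) (be1 be2 z p r : pt) :
  let u := aff al1 be1 in let v := aff al2 be2 in let d := vec (v z) (u z) in
  0 < al1 -> 0 < al2 -> C (u z) -> C (v z) ->
  C (u p) -> ~ C (v p) -> C (v r) -> ~ C (u r) ->
  0 < cross (vec z p) (vec z r) -> 0 <= cross d (vec z r) ->
  0 <= cross d (vec z p) -> False.
Proof.
move=> u v d a1 a2 Cuz Cvz Cup nCvp Cvr nCur.
set k := cross _ _; set i := cross _ _; set j := cross _ _ => k0 i0 j0.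
have ak1 : 0 < al1 * k by rewrite mulr_gt0.
have ak2 : 0 < al2 * k by rewrite mulr_gt0.
have n1 : 0 < i + al1 * k by rewrite ltr_wpDl.
have n2 : 0 < al2 * k + j by rewrite ltr_wpDr.
have [le|/ltW le] := leP (al2 * k + j) (i + al1 * k).
  apply: nCvp.
  (* These are the coefficients given by Cramer's rule for [v p - v z] in terms of [u p - v z] and
     [v r - v z]. *)
  pose a := al2 * k / (i + al1 * k); pose b := j / (i + al1 * k).
  have := convex_comb3 Cconv Cup Cvr Cvz (a := a) (b := b).
  have -> : (a * (u p).1 + b * (v r).1 + (1 - a - b) * (v z).1,
     a * (u p).2 + b * (v r).2 + (1 - a - b) * (v z).2) = v p.
    have := lt0r_neq0 n1; rewrite /a /b /i /j /k /d /u /v /vec /cross /aff => h.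
    by apply: pt_eq; rewrite /=; field; exact: h.
  apply; [by rewrite divr_ge0 // ltW | by rewrite divr_ge0 // ltW |].
  by rewrite /a /b -mulrDl ler_pdivrMr // mul1r.
apply: nCur.
pose a := al1 * k / (al2 * k + j); pose b := i / (al2 * k + j).
have := convex_comb3 Cconv Cvr Cup Cuz (a := a) (b := b).
have -> : (a * (v r).1 + b * (u p).1 + (1 - a - b) * (u z).1,
     a * (v r).2 + b * (u p).2 + (1 - a - b) * (u z).2) = u r.
  have := lt0r_neq0 n2; rewrite /a /b /i /j /k /d /u /v /vec /cross /aff => h.
  by apply: pt_eq; rewrite /=; field; exact: h.
apply; [by rewrite divr_ge0 // ltW | by rewrite divr_ge0 // ltW |].
by rewrite /a /b -mulrDl ler_pdivrMr // mul1r addrC.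
Qed.

(** Of two points on a ray from [z], the nearer lies between [z] and the farther, hence in the
    homothet of the farther. *)
Lemma crossing_ray (al1 al2 : R) (be1 be2 z p r : pt) (m : R) :
  let u := aff al1 be1 in let v := aff al2 be2 in
  C (u z) -> C (v z) -> C (u p) -> ~ C (v p) -> C (v r) -> ~ C (u r) ->
  0 < m -> r = comb z p m -> False.
Proof.
move=> u v Cuz Cvz Cup nCvp Cvr nCur m0 rE.
have [m1|m1] := leP m 1.
  apply: nCur; rewrite rE /u aff_comb; apply: (convex_comb Cconv) => //.
  by rewrite ltW.
apply: nCvp; have -> : p = comb z r m^-1.
  by rewrite rE comb_comb mulVf ?comb1 // gt_eqF.
rewrite /v aff_comb; apply: (convex_comb Cconv) => //.
by rewrite invr_ge0 invf_le1 // !ltW.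
Qed.

Lemma homothets_noncrossing (al1 al2 : R) (be1 be2 p q r s : pt) (a b : R) :
  let u := aff al1 be1 in let v := aff al2 be2 in
  0 < al1 -> 0 < al2 -> C (u p) -> C (u q) -> ~ C (v p) -> ~ C (v q) ->
  C (v r) -> C (v s) -> ~ C (u r) -> ~ C (u s) ->
  0 <= a <= 1 -> 0 <= b <= 1 -> comb p q a = comb r s b -> False.
Proof.
move=> u v a1 a2 Cup Cuq nCvp nCvq Cvr Cvs nCur nCus a01 b01 zE.
pose z := comb p q a.
have Cuz : C (u z) by rewrite /u /z aff_comb; apply: (convex_comb Cconv).
have Cvz : C (v z) by rewrite /v /z zE aff_comb; apply: (convex_comb Cconv).
have [zp zq zr zs] : [/\ z <> p, z <> q, z <> r & z <> s].
  by split=> h; [move: Cvz | move: Cvz | move: Cuz | move: Cuz]; rewrite h.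
have {a01} [a0 a1'] : 0 < a /\ 0 < 1 - a.
  have an0 : a != 0 by apply/eqP => h; apply: zp; rewrite /z h comb0.
  have an1 : a != 1 by apply/eqP => h; apply: zq; rewrite /z h comb1.
  by move: a01; rewrite subr_gt0 !lt_neqAle eq_sym an0 an1 => /andP.
have {b01} [b0 b1'] : 0 < b /\ 0 < 1 - b.
  have bn0 : b != 0 by apply/eqP => h; apply: zr; rewrite /z zE h comb0.
  have bn1 : b != 1 by apply/eqP => h; apply: zs; rewrite /z zE h comb1.
  by move: b01; rewrite subr_gt0 !lt_neqAle eq_sym bn0 bn1 => /andP.
pose D := vec p q; pose F := vec r s.
have pE : vec z p = (- a * D.1, - a * D.2) by apply: pt_eq; rewrite /=; ring.
have qE : vec z q = ((1 - a) * D.1, (1 - a) * D.2) by apply: pt_eq; rewrite /=; ring.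
have rE : vec z r = (- b * F.1, - b * F.2) by rewrite /z zE; apply: pt_eq; rewrite /=; ring.
have sE : vec z s = ((1 - b) * F.1, (1 - b) * F.2) by rewrite /z zE; apply: pt_eq; rewrite /=; ring.
have crossZ (x y : pt) k l : cross (k * x.1, k * x.2) (l * y.1, l * y.2) = k * l * cross x y.
  by rewrite /cross /=; ring.
have crossZr (x y : pt) l : cross x (l * y.1, l * y.2) = l * cross x y.
  by rewrite /cross /=; ring.
pose d := vec (v z) (u z).
have dN x : cross (vec (u z) (v z)) x = - cross d x by rewrite /d /cross /vec /=; ring.
have crossC (x y : pt) : cross y x = - cross x y by rewrite /cross; ring.
(* There is one instance for each pair of ends and each order of the homothets; for non-parallel
   segments the signs of [k], [i] and [j] select one that applies. *)
have := crossing_sign a1 a2 Cuz Cvz Cup nCvp Cvr nCur.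
have := crossing_sign a1 a2 Cuz Cvz Cuq nCvq Cvs nCus.
have := crossing_sign a1 a2 Cuz Cvz Cuq nCvq Cvr nCur.
have := crossing_sign a1 a2 Cuz Cvz Cup nCvp Cvs nCus.
have := crossing_sign a2 a1 Cvz Cuz Cvr nCur Cup nCvp.
have := crossing_sign a2 a1 Cvz Cuz Cvs nCus Cuq nCvq.
have := crossing_sign a2 a1 Cvz Cuz Cvr nCur Cuq nCvq.
have := crossing_sign a2 a1 Cvz Cuz Cvs nCus Cup nCvp.
rewrite -/u -/v !dN -/d pE qE rE sE !crossZ !crossZr !(crossC D F).
set k := cross D F; set i := cross d F; set j := cross d D.
move: a1' b1'; set a' := 1 - a; set b' := 1 - b => a1' b1'.
have ab := mulr_gt0 a0 b0; have ab' := mulr_gt0 a0 b1'.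
have a'b := mulr_gt0 a1' b0; have a'b' := mulr_gt0 a1' b1'.
have [k0|k0|k0] := ltgtP k 0.
- move=> _ _ h3 h4 h5 h6 _ _.
  by case: (lerP 0 i) => i0; case: (lerP 0 j) => j0;
    [apply: h4|apply: h5|apply: h6|apply: h3];
    rewrite ?(mulNr, mulrN) ?opprK ?oppr_gt0 ?oppr_ge0 ?(pmulr_rgt0, pmulr_rlt0, pmulr_rge0, pmulr_rle0) //; exact: ltW.
- move=> h1 h2 _ _ _ _ h7 h8.
  by case: (lerP 0 i) => i0; case: (lerP 0 j) => j0;
    [apply: h7|apply: h2|apply: h1|apply: h8];
    rewrite ?(mulNr, mulrN) ?opprK ?oppr_gt0 ?oppr_ge0 ?(pmulr_rgt0, pmulr_rlt0, pmulr_rge0, pmulr_rle0) //; exact: ltW.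
(* The segments are parallel, so all ends lie on one line through [z], and the sign of [m] tells
   whether [r] is on the side of [p] or of [q]. *)
move=> _ _ _ _ _ _ _ _.
have Dn : 0 < D.1 ^+ 2 + D.2 ^+ 2.
  rewrite lt_def addr_ge0 ?sqr_ge0 // andbT paddr_eq0 ?sqr_ge0 // !sqrf_eq0.
  rewrite !subr_eq0; apply/negP => /andP[/eqP h1 /eqP h2]; apply: zp.
  by apply: pt_eq; rewrite /z /= ?h1 ?h2; ring.
pose m := (F.1 * D.1 + F.2 * D.2) / (D.1 ^+ 2 + D.2 ^+ 2).
have F1 : F.1 = m * D.1.
  apply: (mulIf (lt0r_neq0 Dn)); apply/eqP; rewrite -subr_eq0; apply/eqP.
  transitivity (- D.2 * k); last by rewrite k0 mulr0.
  by rewrite /m /k /cross; field; exact: lt0r_neq0.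
have F2 : F.2 = m * D.2.
  apply: (mulIf (lt0r_neq0 Dn)); apply/eqP; rewrite -subr_eq0; apply/eqP.
  transitivity (D.1 * k); last by rewrite k0 mulr0.
  by rewrite /m /k /cross; field; exact: lt0r_neq0.
have rz : r = (z.1 - b * m * D.1, z.2 - b * m * D.2).
  have r1 : r.1 = z.1 - b * F.1 by rewrite /z zE /=; ring.
  have r2 : r.2 = z.2 - b * F.2 by rewrite /z zE /=; ring.
  by apply: pt_eq; rewrite ?r1 ?r2 ?F1 ?F2 mulrA.
have [m0|m0|m0] := ltgtP m 0.
- apply: (crossing_ray (m := - (b * m) / a') Cuz Cvz Cuq nCvq Cvr nCur).
    by rewrite divr_gt0 // oppr_gt0 pmulr_rlt0.
  by rewrite rz; apply: pt_eq; rewrite /z /D /a' /=; field; exact: lt0r_neq0.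
- apply: (crossing_ray (m := (b * m) / a) Cuz Cvz Cup nCvp Cvr nCur).
    by rewrite divr_gt0 // mulr_gt0.
  by rewrite rz; apply: pt_eq; rewrite /z /D /=; field; exact: lt0r_neq0.
by apply: zr; rewrite rz m0 mulr0 !mul0r !subr0; case: (z).
Qed.
End Planarity.

(** * Illumination by four directions *)

Section Illumination.
Variable R : realType.
Local Notation pt := (R * R)%type.
Implicit Types (k l e : R) (c p q t b v w z f : pt).

Definition lin f z : R := f.1 * z.1 + f.2 * z.2.
Definition ray c v k : pt := (c.1 + k * v.1, c.2 + k * v.2).

Lemma lin_comb f x y k : lin f (comb x y k) = (1 - k) * lin f x + k * lin f y.
Proof. by rewrite /lin /=; ring. Qed.

Lemma lin_ray f c v k : lin f (ray c v k) = lin f c + k * lin f v.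
Proof. by rewrite /lin /=; ring. Qed.

Lemma ray_vec c z : ray c (vec c z) 1 = z.
Proof. by apply: pt_eq; rewrite /=; ring. Qed.

(** This is the map of ratio [k] that sends [t] to [c]: it puts [t] at a prescribed place of the
    homothet. *)
Lemma aff_ray k c t z : aff k (ray c t (- k)) z = ray c (vec t z) k.
Proof. by apply: pt_eq; rewrite /=; ring. Qed.

Lemma lin_vec f x y : lin f (vec x y) = lin f y - lin f x.
Proof. by rewrite /lin /=; ring. Qed.

Lemma lin_opp f z : lin (- f.1, - f.2) z = - lin f z.
Proof. by rewrite /lin /=; ring. Qed.

Lemma lin_sqr_gt0 f : f != (0, 0) -> 0 < lin f f.
Proof.
move=> f0; rewrite /lin -!expr2 lt_def addr_ge0 ?sqr_ge0 // andbT.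
rewrite paddr_eq0 ?sqr_ge0 // !sqrf_eq0; apply: contra f0 => /andP[/eqP h1 /eqP h2].
by apply/eqP/pt_eq.
Qed.

Variable C : set pt.
Hypothesis Cscb : strictly_convex_body C.
Let Cconv : Defs.convex_set C. Proof. by case: Cscb => -[]. Qed.
Let Ccompact : compact C. Proof. by case: Cscb => -[]. Qed.

Lemma interior_ray c v k : interior C (ray c v k) ->
  exists2 d, 0 < d & interior C (ray c v (k + d)).
Proof.
move=> kint; have : nbhs (ray c v k) (interior C).
  by apply: open_nbhs_nbhs; split=> //; exact: open_interior.
move=> /(nbhs_comb (ray c v (k + 1)))[d d0 hd]; exists d => //.
have -> : ray c v (k + d) = comb (ray c v k) (ray c v (k + 1)) d.
  by apply: pt_eq; rewrite /=; ring.
by apply: hd; rewrite gtr0_norm.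
Qed.

Lemma interior_lin_lt f c z : f != (0, 0) ->
  (forall z, C z -> lin f z <= lin f c) -> interior C z -> lin f z < lin f c.
Proof.
move=> f0 fmax zint; have z0 : ray z f 0 = z by apply: pt_eq; rewrite /=; ring.
rewrite -z0 in zint; have [d d0] := interior_ray zint.
move/interior_subset/fmax; rewrite lin_ray; apply: lt_le_trans.
by rewrite add0r ltrDl mulr_gt0 // lin_sqr_gt0.
Qed.

(** The midpoint of two maximisers would be an interior maximiser. *)
Lemma lin_max_strict f : f != (0, 0) -> exists2 c, C c &
  forall z, C z -> z != c -> lin f z < lin f c.
Proof.
move=> f0; have [c Cc cmax] := linear_max Cscb f.1 f.2; exists c => // z Cz zc.
have half : 0 < (2^-1 : R) < 1 by rewrite invr_gt0 ltr0n invf_lt1 ?ltr1n ?ltr0n.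
have := interior_lin_lt f0 cmax (comb_interior Cscb Cz Cc zc half).
by rewrite lin_comb; lra.
Qed.

(** Along the ray [f] grows and [g] decreases, so it leaves the corner region of [c] through one of
    two segments known to be interior: at [s] where [f] reaches its value at [t], or earlier, at
    [s2], where [g] falls to its value at [p]. *)
Lemma illuminated_arc f g p t c v :
  (forall z, C z -> z != p -> lin f p < lin f z) ->
  (forall z, C z -> z != t -> lin g z < lin g t) ->
  (forall z, lin g z = lin g p -> lin f p < lin f z <= lin f t -> interior C z) ->
  (forall z, lin f z = lin f t -> lin g p <= lin g z < lin g t -> interior C z) ->
  0 < lin f v -> lin g v < 0 -> C c -> c != p -> c != t ->
  lin g p <= lin g c -> lin f c <= lin f t ->
  exists2 k, 0 < k & interior C (ray c v k).
Proof.
move=> pmin tmax hseg vseg fv gv Cc cp ct gc fc.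
have fpc := pmin _ Cc cp; have gct := tmax _ Cc ct.
suff [k k0 hk] : exists2 k, 0 <= k & interior C (ray c v k).
  by have [d d0 hd] := interior_ray hk; exists (k + d) => //; rewrite ltr_wpDl.
pose s := (lin f t - lin f c) / lin f v.
have s0 : 0 <= s by rewrite divr_ge0 ?subr_ge0 // ltW.
have fs : lin f (ray c v s) = lin f t.
  by rewrite lin_ray /s divfK ?gt_eqF // addrC subrK.
have [le|lt] := leP (lin g p) (lin g (ray c v s)).
  exists s => //; apply: vseg => //; rewrite le /= lin_ray.
  by apply: le_lt_trans gct; rewrite gerDl mulr_ge0_le0 // ltW.
pose s2 := (lin g p - lin g c) / lin g v.
have s20 : 0 <= s2 by rewrite mulr_le0 ?subr_le0 // invr_le0 ltW.
have gs2 : lin g (ray c v s2) = lin g p.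
  by rewrite lin_ray /s2 divfK ?lt_eqF // addrC subrK.
exists s2 => //; apply: hseg => //.
have s2s : s2 <= s.
  rewrite leNgt; apply/negP => h; move: lt; rewrite -gs2 !lin_ray ltrD2l.
  by rewrite ltr_nM2r // => h'; have := lt_trans h h'; rewrite ltxx.
rewrite -fs !lin_ray lerD2l ler_pM2r // s2s andbT.
by apply: lt_le_trans fpc _; rewrite lerDl mulr_ge0 // ltW.
Qed.

Lemma illumination : exists2 dirs : seq pt,
  size dirs = 4 /\ (forall v, v \in dirs -> v.1 != 0) &
  forall c, C c -> exists2 v, v \in dirs &
    exists2 k, 0 < k & interior C (ray c v k).
Proof.
(* The four directions are attached to the leftmost and rightmost points [p],
   [q] and to the two points [t], [b] extreme for the functional [g] that takes
   equal values at [p] and [q]; each lights one of these points and one of the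
   four arcs between them. *)
have [q Cq qmax] := @lin_max_strict (1, 0) (ltac:(by rewrite xpair_eqE oner_eq0)).
have [p Cp pmax] := @lin_max_strict (-1, 0) (ltac:(by rewrite xpair_eqE oppr_eq0 oner_eq0)).
have {}qmax z : C z -> z != q -> z.1 < q.1.
  by move=> Cz /(qmax _ Cz); rewrite /lin /=; lra.
have {}pmax z : C z -> z != p -> p.1 < z.1.
  by move=> Cz /(pmax _ Cz); rewrite /lin /=; lra.
have pq : p.1 < q.1.
  have [ o oint] : interior C !=set0 by case: Cscb => -[].
  have f0 : (1, 0) != (0, 0) :> pt by rewrite xpair_eqE oner_eq0.
  have Co := interior_subset oint.
  have qle z : C z -> lin (1, 0) z <= lin (1, 0) q.
    by move=> Cz; have [->//|/(qmax _ Cz)] := eqVneq z q; rewrite /lin /=; lra.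
  have := interior_lin_lt f0 qle oint; rewrite /lin /=.
  by have [<-|/(pmax _ Co)] := eqVneq o p; lra.
pose f : pt := (1, 0).
pose g : pt := (- (q.2 - p.2), q.1 - p.1).
have dpos : 0 < q.1 - p.1 by rewrite subr_gt0.
have dn0 := lt0r_neq0 dpos.
have g0 : g != (0, 0) by rewrite xpair_eqE negb_and dn0 orbT.
have gN0 : (- g.1, - g.2) != (0, 0) :> pt.
  by rewrite xpair_eqE !oppr_eq0 negb_and dn0 orbT.
have gpq : lin g q = lin g p by rewrite /lin /g /=; ring.
have [t Ct tmax] := lin_max_strict g0.
have [b Cb bmax] := lin_max_strict gN0.
have {}bmax z : C z -> z != b -> lin g b < lin g z.
  by move=> Cz /(bmax _ Cz); rewrite !lin_opp ltrN2.
have pneq : p != q by apply: contraTneq pq => ->; rewrite ltxx.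
have gpt : lin g p < lin g t.
  have [tp|tp] := eqVneq p t; last exact: tmax.
  by rewrite -gpq; apply: tmax; rewrite // -tp eq_sym.
have gbp : lin g b < lin g p.
  have [bp|bp] := eqVneq p b; last exact: bmax.
  by rewrite -gpq; apply: bmax; rewrite // -bp eq_sym.
have neqg x y : lin g x < lin g y -> x != y by apply: contraTneq => ->; rewrite ltxx.
have pt1 : p.1 < t.1 by apply: pmax; rewrite // eq_sym; exact: neqg.
have tq1 : t.1 < q.1 by apply: qmax; rewrite // eq_sym; apply: neqg; rewrite gpq.
have pb1 : p.1 < b.1 by apply: pmax; rewrite //; exact: neqg.
have bq1 : b.1 < q.1 by apply: qmax; rewrite //; apply: neqg; rewrite gpq.
(* The point with abscissa [x] at which [g] equals [y]. *)
pose mk (x y : R) : pt := (x, (y + (q.2 - p.2) * x) / (q.1 - p.1)).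
have mkg x y : lin g (mk x y) = y by rewrite /lin /g /mk /=; field.
have coord x y : x.1 = y.1 -> lin g x = lin g y -> x = y.
  move=> h1; rewrite /lin h1 => /addrI h2; apply: pt_eq => //.
  exact: (mulfI dn0).
have hseg z : lin g z = lin g p -> p.1 < z.1 < q.1 -> interior C z.
  move=> gz /andP[z1 z2].
  have -> : z = comb p q ((z.1 - p.1) / (q.1 - p.1)).
    by apply: coord; [rewrite /=; field | rewrite lin_comb gpq gz; ring].
  apply: comb_interior => //; rewrite divr_gt0 ?subr_gt0 //=.
  by rewrite ltr_pdivrMr // mul1r ltrD2r.
have vseg y z : C y -> p.1 < y.1 < q.1 -> lin g y != lin g p -> z.1 = y.1 ->
    0 <= (lin g z - lin g p) / (lin g y - lin g p) < 1 -> interior C z.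
  move=> Cy hy gy zy hk.
  have -> : z = comb (mk y.1 (lin g p)) y ((lin g z - lin g p) / (lin g y - lin g p)).
    apply: coord; first by rewrite /= zy; ring.
    by rewrite lin_comb mkg; field; rewrite subr_eq0.
  by apply: interior_comb => //; apply: hseg; rewrite ?mkg.
have vsegt z : z.1 = t.1 -> lin g p <= lin g z < lin g t -> interior C z.
  move=> h1 /andP[h2 h3]; apply: (vseg t) => //; first by rewrite pt1.
    by rewrite gt_eqF.
  by rewrite divr_ge0 ?subr_ge0 ?(ltW gpt) // ltr_pdivrMr ?subr_gt0 // mul1r ltrD2r.
have vsegb z : z.1 = b.1 -> lin g b < lin g z <= lin g p -> interior C z.
  move=> h1 /andP[h2 h3]; apply: (vseg b) => //; first by rewrite pb1.
    by rewrite lt_eqF.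
  have neg : lin g b - lin g p < 0 by rewrite subr_lt0.
  by rewrite ler_ndivlMr // mul0r subr_le0 h3 ltr_ndivrMr // mul1r ltrD2r.
(* Interior targets for [p], [t], [q] and [b], chosen so that the directions towards them have the
   signs that [illuminated_arc] asks for. *)
pose w1 := mk b.1 ((lin g b + lin g p) / 2).
pose w2 := mk ((p.1 + t.1) / 2) (lin g p).
pose w3 := mk t.1 ((lin g t + lin g p) / 2).
pose w4 := mk ((b.1 + q.1) / 2) (lin g p).
have w1int : interior C w1 by apply: vsegb; rewrite // mkg; lra.
have w2int : interior C w2 by apply: hseg; rewrite ?mkg //=; lra.
have w3int : interior C w3 by apply: vsegt; rewrite // mkg; lra.
have w4int : interior C w4 by apply: hseg; rewrite ?mkg //=; lra.
exists [:: vec p w1; vec t w2; vec q w3; vec b w4].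
  split=> // v; rewrite !inE => /or4P[]/eqP->; rewrite /vec /=.
  - by rewrite gt_eqF // subr_gt0.
  - by rewrite lt_eqF //; lra.
  - by rewrite lt_eqF // subr_lt0.
  - by rewrite gt_eqF //; lra.
have end_ c w : interior C w -> exists2 k, 0 < k & interior C (ray c (vec c w) k).
  by move=> wint; exists 1; rewrite ?ltr01 // ray_vec.
have linf z : lin f z = z.1 by rewrite /lin /f /=; ring.
pose f' : pt := (-1, 0); pose g' : pt := (- g.1, - g.2).
have linf' z : lin f' z = - z.1 by rewrite /lin /f' /=; ring.
have ling' z : lin g' z = - lin g z by exact: lin_opp.
move=> c Cc.
have [->|cp] := eqVneq c p; first by exists (vec p w1); rewrite ?inE ?eqxx //; exact: end_.
have [->|ct] := eqVneq c t; first by exists (vec t w2); rewrite ?inE ?eqxx ?orbT //; exact: end_.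
have [->|cq] := eqVneq c q; first by exists (vec q w3); rewrite ?inE ?eqxx ?orbT //; exact: end_.
have [->|cb] := eqVneq c b; first by exists (vec b w4); rewrite ?inE ?eqxx ?orbT //; exact: end_.
have [gc|/ltW gc] := leP (lin g p) (lin g c).
  have [fc|/ltW fc] := leP c.1 t.1.
    exists (vec p w1); first by rewrite inE eqxx.
    apply: (@illuminated_arc f g p t); rewrite ?lin_vec ?linf ?mkg //=.
    - by move=> z; rewrite !linf; exact: pmax.
    - by move=> z gz; rewrite !linf => hz; apply: hseg => //; lra.
    - by move=> z; rewrite !linf; exact: vsegt.
    - by rewrite subr_gt0.
    - by lra.
  exists (vec t w2); first by rewrite !inE eqxx orbT.
  apply: (@illuminated_arc f' g q t); rewrite ?lin_vec ?linf' ?mkg ?gpq //=.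
  - by move=> z Cz zq; rewrite !linf' ltrN2; exact: qmax.
  - by move=> z gz; rewrite !linf' => hz; apply: hseg => //; lra.
  - by move=> z; rewrite !linf' => /oppr_inj; exact: vsegt.
  - by lra.
  - by lra.
  - by rewrite lerN2.
have [fc|/ltW fc] := leP b.1 c.1.
  exists (vec q w3); first by rewrite !inE eqxx !orbT.
  apply: (@illuminated_arc f' g' q b); rewrite ?lin_vec ?linf' ?ling' ?mkg ?gpq ?lerN2 //=.
  - by move=> z Cz zq; rewrite !linf' ltrN2; exact: qmax.
  - by move=> z Cz zb; rewrite !ling' ltrN2; exact: bmax.
  - by move=> z; rewrite !ling' => /oppr_inj gz; rewrite !linf' => hz; apply: hseg; rewrite ?gz ?gpq //; lra.
  - move=> z; rewrite !linf' !ling' ?gpq lerN2 ltrN2 => /oppr_inj h1 /andP[h2 h3].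
    by apply: vsegb; rewrite // h2 h3.
  - by lra.
  - by lra.
exists (vec b w4); first by rewrite !inE eqxx !orbT.
apply: (@illuminated_arc f g' p b); rewrite ?lin_vec ?linf ?ling' ?mkg ?lerN2 //=.
- by move=> z; rewrite !linf; exact: pmax.
- by move=> z Cz zb; rewrite !ling' ltrN2; exact: bmax.
- by move=> z; rewrite !ling' => /oppr_inj gz; rewrite !linf => hz; apply: hseg => //; lra.
- move=> z; rewrite !linf !ling' lerN2 ltrN2 => h1 /andP[h2 h3].
  by apply: vsegb; rewrite // h2 h3.
- by lra.
- by lra.
Qed.

(** If direction [v] lights [c] at distance [s], the point [v / e] scaled by [s * e] and seen from
    [x] is off by only [s * e * x]. Compactness of [C] gives one [e] for all [c]. *)
Lemma far_points (S : seq pt) : exists Q : seq pt,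
  [/\ size Q = 4, forall x, x \in Q -> x \notin S &
   forall c x, C c -> x \in S -> exists q al,
     [/\ q \in Q, 0 < al & C (ray c (vec x q) al)]].
Proof.
have [dirs [sz dir0] ill] := illumination.
pose far e v : pt := (v.1 / e, v.2 / e).
pose K e c := forall x, x \in S -> exists v al,
  [/\ v \in dirs, 0 < al & C (ray c (vec x (far e v)) al)].
have step : \forall e \near 0^'+, C `<=` K e.
  have /compact_near_coveringP := Ccompact; apply=> c Cc.
  have [v vd [s s0 /nbhs_square[d d0 hd]]] := ill _ Cc.
  have [|m /andP[m0 _] hm] := @small_all R _ S
    (fun x e => s * (e * `|x.1|) <= d / 2 /\ s * (e * `|x.2|) <= d / 2).
    move=> x _; pose N := s * (1 + `|x.1| + `|x.2|).
    have h1 := normr_ge0 x.1; have h2 := normr_ge0 x.2.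
    have N0 : 0 < N by rewrite mulr_gt0 //; lra.
    exists (d / 2 / N); first by rewrite !divr_gt0.
    move=> e /andP[e0]; rewrite ler_pdivlMr // /N => eN.
    have es : 0 < e * s by rewrite mulr_gt0.
    by split; nra.
  exists ([set c' | `|c'.1 - c.1| < d / 2 /\ `|c'.2 - c.2| < d / 2],
          [set e | 0 < e <= m]).
    split=> /=.
      by apply: (square_nbhs (d := d / 2)); rewrite ?divr_gt0.
    near=> e; apply/andP; split; near: e; first exact: nbhs_right_gt.
    exact: nbhs_right_le.
  move=> [c' e] /= [[c1 c2] /andP[e0 em]] x xS.
  exists v, (s * e); split=> //; first by rewrite mulr_gt0.
  have [|h1 h2] := hm x e xS; first by rewrite e0.
  have en := lt0r_neq0 e0.
  have k1 (y : R) : `|s * e * y| = s * (e * `|y|).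
    by rewrite !normrM (gtr0_norm s0) (gtr0_norm e0) mulrA.
  apply: hd.
    have -> : (ray c' (vec x (far e v)) (s * e)).1 - (ray c v s).1 =
      (c'.1 - c.1) - s * e * x.1 by rewrite /=; field.
    by apply: le_trans (ler_normB _ _) _; rewrite k1; lra.
  have -> : (ray c' (vec x (far e v)) (s * e)).2 - (ray c v s).2 =
    (c'.2 - c.2) - s * e * x.2 by rewrite /=; field.
  by apply: le_trans (ler_normB _ _) _; rewrite k1; lra.
(* As [v.1] is nonzero, [v / e] moves away from every point of [S] when [e] is small. *)
have [|m /andP[m0 _] hm] := @small_all R _ (allpairs pair dirs S)
  (fun vx e => far e vx.1 != vx.2).
  move=> [v x] /allpairsP[[v' x'] [/= vd _ [-> _]]].
  have v0 := dir0 _ vd.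
  exists (`|v'.1| / (1 + `|x.1|)).
    by rewrite divr_gt0 ?normr_gt0 // ltr_pwDl.
  move=> e /andP[e0]; rewrite ler_pdivlMr ?ltr_pwDl // => he.
  apply/eqP => /(congr1 (fun w => `|w.1|)) /=.
  rewrite normrM normfV (gtr0_norm e0) => h.
  have : `|v'.1| = e * `|x.1| by rewrite -h mulrC divfK // gt_eqF.
  by move=> h'; move: he; rewrite h' mulrDr mulr1; lra.
have [e [[e0 em] Ke]] : exists e, (0 < e /\ e <= m) /\ C `<=` K e.
  apply: (@filter_ex _ 0^'+); near=> e; split; last by near: e.
  by split; near: e; [exact: nbhs_right_gt | exact: nbhs_right_le].
exists [seq far e v | v <- dirs]; split; first by rewrite size_map.
  move=> _ /mapP[v vd ->]; apply/negP => vS.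
  have := hm (v, far e v) e; rewrite /= eqxx e0 em => /(_ _ isT) h.
  by have : false by apply: h; apply/allpairsP; exists (v, far e v).
move=> c x Cc xS; have [v [al [vd al0 h]]] := Ke _ Cc _ xS.
by exists (far e v), al; split=> //; apply: map_f.
Unshelve. all: by end_near. Qed.

(** With [t] sent to a fixed point of [C] and a large ratio, any other [s] is carried beyond the
    maximum over [C] of the functional in direction [s - t]. *)
Lemma isolating_homothet (S : seq pt) t : exists al be,
  [/\ 0 < al, C (aff al be t) & forall s, s \in S -> C (aff al be s) -> s = t].
Proof.
have [c /interior_subset Cc] : interior C !=set0 by case: Cscb => -[].
have [|d /andP[d0 _] hd] := @small_all R _ S
  (fun s e => C (ray c (vec t s) e^-1) -> s = t).
  move=> s _; have [st|st] := eqVneq s t; first by exists 1; rewrite ?ltr01.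
  pose w := vec t s.
  have w0 : w != (0, 0).
    by apply: contra_neq st => -[/subr0_eq h1 /subr0_eq h2]; exact: pt_eq.
  have ww := lin_sqr_gt0 w0.
  have [m Cm mmax] : exists2 m, C m & forall z, C z -> lin w z <= lin w m.
    exact: linear_max.
  have mc : 0 <= lin w m - lin w c by rewrite subr_ge0; exact: mmax.
  have mc1 : 0 < 1 + (lin w m - lin w c) by rewrite ltr_pwDl.
  exists (lin w w / (1 + (lin w m - lin w c))); first by rewrite divr_gt0.
  move=> e /andP[e0]; rewrite ler_pdivlMr // => he Ce.
  have := mmax _ Ce; rewrite lin_ray => h.
  have h2 : lin w w <= e * (lin w m - lin w c) by rewrite -ler_pdivrMl //; lra.
  by exfalso; move: he; rewrite mulrDr mulr1; lra.
exists d^-1, (ray c t (- d^-1)); split; rewrite ?invr_gt0 //.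
  rewrite aff_ray; suff -> : ray c (vec t t) d^-1 = c by [].
  by apply: pt_eq; rewrite /=; ring.
by move=> s sS; rewrite aff_ray; apply: hd; rewrite // d0 lexx.
Qed.
End Illumination.

(** * Covering by pairs *)

Section Independent.
Variables (R : realType) (C : set (R * R)).
Local Notation pt := (R * R)%type.
Hypothesis Cscb : strictly_convex_body C.
Implicit Types (A T Q S V : seq pt) (t u v z f : pt).

Let Cconv : Defs.convex_set C. Proof. by case: Cscb => -[]. Qed.

(** [m] exceeds the absolute values of all the finitely many ratios at which two points collide. *)
Lemma generic_direction S : exists m : R, forall x y, x \in S -> y \in S ->
  x.1 + m * x.2 = y.1 + m * y.2 -> x = y.
Proof.
pose r (xy : pt * pt) := `|(xy.2.1 - xy.1.1) / (xy.1.2 - xy.2.2)|.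
pose m := 1 + \sum_(xy <- [seq (x, y) | x <- S, y <- S]) r xy.
exists m => x y xS yS h.
have [h2|h2] := eqVneq x.2 y.2; first by apply: pt_eq => //; move: h; rewrite h2; lra.
have n2 : x.2 - y.2 != 0 by rewrite subr_eq0.
have mE : m = (y.1 - x.1) / (x.2 - y.2).
  by apply: (mulIf n2); rewrite divfK //; lra.
have : r (x, y) < m.
  have xyS : (x, y) \in [seq (x, y) | x <- S, y <- S].
    by apply/allpairsP; exists (x, y).
  rewrite /m (big_rem _ xyS) /= addrCA ltrDl ltr_wpDr //.
  by apply: sumr_ge0 => i _; exact: normr_ge0.
by rewrite {1}/r /= -mE ltNge ler_norm.
Qed.

Section Extension.
Variables (A T Q : seq pt).
Hypothesis TA : forall t, t \in T -> t \notin A.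
Hypothesis TQ : forall q, q \in Q -> q \notin T.
Hypothesis T_separated : forall t u al be, t \in T -> u \in T -> t != u ->
  0 < al -> C (aff al be t) -> C (aff al be u) ->
  exists2 a, a \in A & C (aff al be a).
Hypothesis Q_far : forall c x, C c -> x \in T -> exists q al,
  [/\ q \in Q, 0 < al & C (ray c (vec x q) al)].

Let V := A ++ Q.
Definition bip_edge t v : Prop :=
  [/\ t \in T, v \in A ++ Q & delaunay C (T ++ (A ++ Q)) t v].

Lemma T_notin_V t : t \in T -> t \notin V.
Proof.
move=> tT; rewrite mem_cat negb_or TA //=.
by apply/negP => /TQ; rewrite tT.
Qed.

(** The homothet that has [t] at the unique maximiser of [f] lies, except for [t], in the open
    half-plane, and it can be chosen to contain a point of [Q]. It thus yields a Delaunay neighbour,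
    which is not in [T] because a homothet containing two points of [T] also contains a point of
    [A]. *)
Lemma bip_edge_halfplane f t : f != (0, 0) -> t \in T ->
  exists2 v, bip_edge t v & lin f v < lin f t.
Proof.
move=> f0 tT; have [c Cc cmax] := lin_max_strict Cscb f0.
have [q [al [qQ al0 Cq]]] := Q_far Cc tT.
have Ct : C (aff al (ray c t (- al)) t).
  by rewrite aff_ray; suff -> : ray c (vec t t) al = c by []; apply: pt_eq; rewrite /=; ring.
have qt : q != t by apply: contraTneq (TQ qQ) => ->; rewrite tT.
have tTV : t \in T ++ V by rewrite mem_cat tT.
have qTV : q \in T ++ V by rewrite !mem_cat qQ !orbT.
rewrite -aff_ray in Cq.
have [v [vTV vt Cv tv]] := delaunay_neighbor Cscb tTV qTV qt al0 Ct Cq.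
exists v; last first.
  have vc : ray c (vec t v) al != c.
    apply: contra_neq vt => h; have := congr1 (fun w => w.1) h; have := congr1 (fun w => w.2) h.
    move=> /= h2 h1; have aln := lt0r_neq0 al0.
    by apply: pt_eq; apply: (mulfI aln); lra.
  rewrite aff_ray in Cv; have := cmax _ Cv vc.
  by rewrite lin_ray lin_vec gtrDl pmulr_rlt0 // subr_lt0.
split=> //; move: vTV; rewrite mem_cat => /orP[vT|//].
have [a2 [b2 [a20 C2t C2v h2]]] := tv.
rewrite eq_sym in vt.
have [a aA Ca] := T_separated tT vT vt a20 C2t C2v.
have aTV : a \in T ++ V by rewrite !mem_cat aA orbT.
by have [ae|ae] := h2 a aTV Ca; [move: (TA tT)|move: (TA vT)]; rewrite -ae aA.
Qed.

(** The coordinates arise by a shear, so segments stay segments; the homothet of an edge contains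
    only its two ends, so [homothets_noncrossing] applies. *)
Lemma bip_edge_drawing (m : R) :
  (forall x y, x \in T ++ V -> y \in T ++ V ->
     x.1 + m * x.2 = y.1 + m * y.2 -> x = y) ->
  bipartite_drawing T V bip_edge (fun z => z.1 + m * z.2) (fun z => z.2).
Proof.
move=> Xinj.
have combE (x y z w : pt) (s s' : R) :
    (1 - s) * (x.1 + m * x.2) + s * (y.1 + m * y.2) =
    (1 - s') * (z.1 + m * z.2) + s' * (w.1 + m * w.2) ->
    (1 - s) * x.2 + s * y.2 = (1 - s') * z.2 + s' * w.2 ->
    comb x y s = comb z w s'.
  move=> h1 h2; apply: pt_eq; last exact: h2.
  have {h2}h2 := congr1 ( *%R m) h2.
  by rewrite /=; move: h1 h2; rewrite !mulrDr !(mulrCA m); lra.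
split=> //.
- by move=> t v [].
- exact: T_notin_V.
- move=> t v t' v' s s' [tT vV [al [be [al0 Ct Cv h]]]].
  move=> [t'T v'V [al' [be' [al'0 Ct' Cv' h']]]] hs hs' hX hY.
  have cE := combE _ _ _ _ _ _ hX hY.
  apply: contrapT => /not_orP[tt vv].
  have nT x y : x \in T -> y \in V -> x <> y.
    by move=> xT yV xy; move: (T_notin_V xT); rewrite xy yV.
  have TV x : x \in T -> x \in T ++ V by rewrite mem_cat => ->.
  have VV x : x \in V -> x \in T ++ V by move=> xV; rewrite mem_cat xV orbT.
  apply: (homothets_noncrossing Cconv al0 al'0 Ct Cv _ _ Ct' Cv' _ _ hs hs' cE).
  - by move=> /(h' _ (TV _ tT)) [//|]; exact: nT.
  - by move=> /(h' _ (VV _ vV)) [/esym|//]; exact: nT.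
  - by move=> /(h _ (TV _ t'T)) [/esym //|]; exact: nT.
  - by move=> /(h _ (VV _ v'V)) [/esym|/esym//]; exact: nT.
move=> t v a s [tT vV [al [be [al0 Ct Cv h]]]] aTV hs hX hY.
apply: h => //; have -> : a = comb t v s.
  rewrite -(comb0 a a); apply: combE; rewrite ?hX ?hY; ring.
by rewrite aff_comb; apply: convex_comb.
Qed.

Lemma separated_size_far : uniq T -> (size T <= 2 * size (A ++ Q))%N.
Proof.
move=> Tuniq; have [m Xinj] := generic_direction (T ++ V).
have linX (z : pt) : lin (1, m) z = z.1 + m * z.2 by rewrite /lin /=; ring.
have linNX (z : pt) : lin (-1, - m) z = - (z.1 + m * z.2) by rewrite /lin /=; ring.
have f0 : (1, m) != (0, 0) :> pt by rewrite xpair_eqE oner_eq0.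
have fN0 : (-1, - m) != (0, 0) :> pt by rewrite xpair_eqE oppr_eq0 oner_eq0.
apply: (drawing_size (bip_edge_drawing Xinj) Tuniq).
- by move=> t tT; have [v e] := bip_edge_halfplane f0 tT; rewrite !linX; exists v.
- move=> t tT; have [v e] := bip_edge_halfplane fN0 tT; rewrite !linNX ltrN2.
  by exists v.
move=> t a b [tT aV _] _.
(* [g] is constant on the line through [t] and [a]; a neighbour strictly on the side of this line
   away from [b] is a third one. *)
pose g : pt := (- (a.2 - t.2), a.1 - t.1).
have ga : lin g a = lin g t by rewrite /lin /g /=; ring.
have g0 : g != (0, 0).
  apply: contraTneq (T_notin_V tT) => -[/eqP h2 /subr0_eq h1].
  suff -> : t = a by rewrite aV.
  by apply: pt_eq; rewrite ?h1 //; apply/eqP; rewrite eq_sym -subr_eq0 -oppr_eq0.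
have gN0 : (- g.1, - g.2) != (0, 0) :> pt.
  by move: g0; rewrite !xpair_eqE !oppr_eq0.
have neq f x y : lin f x < lin f y -> x != y by apply: contraTneq => ->; rewrite ltxx.
have [gb|/ltW gb] := leP (lin g t) (lin g b).
  have [v e vt] := bip_edge_halfplane g0 tT; exists v; split=> //.
    by apply: (neq g); rewrite ga.
  by apply: (neq g); apply: lt_le_trans vt gb.
have [v e vt] := bip_edge_halfplane gN0 tT; exists v; split=> //.
  by apply: (neq (- g.1, - g.2)); rewrite [ltRHS]lin_opp ga -lin_opp.
by apply: (neq (- g.1, - g.2)); apply: lt_le_trans vt _; rewrite !lin_opp lerN2.
Qed.
End Extension.

Lemma separated_size A T : uniq T -> (forall t, t \in T -> t \notin A) ->
  (forall t u al be, t \in T -> u \in T -> t != u -> 0 < al ->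
     C (aff al be t) -> C (aff al be u) -> exists2 a, a \in A & C (aff al be a)) ->
  (size T <= 2 * size A + 8)%N.
Proof.
move=> Tuniq TA sep; have [Q [sQ TQ Qfar]] := far_points Cscb T.
by have := separated_size_far TA TQ sep Qfar Tuniq; rewrite size_cat sQ mulnDr.
Qed.

Lemma separated_pairing (S : seq pt) : uniq S -> exists (K : nat)
    (p1 p2 : 'I_K -> pt),
  [/\ (2 * 3 * K <= 4 * size S + 16)%N,
      forall s, s \in S -> exists i, s = p1 i \/ s = p2 i &
      forall i, exists al be, [/\ 0 < al, C (aff al be (p1 i)),
        C (aff al be (p2 i)) &
        forall s, s \in S -> C (aff al be s) -> s = p1 i \/ s = p2 i]].
Proof.
move=> Suniq; pose n := size S; pose p (i : 'I_n) := tnth (in_tuple S) i.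
have pS i : p i \in S by exact: mem_tnth.
have p_inj : injective p.
  by move=> i j; rewrite /p !(tnth_nth (0, 0)) => /eqP; rewrite nth_uniq // => /eqP/val_inj.
have pP s : s \in S -> exists i, s = p i by case/seq_tnthP => i ->; exists i.
pose e (i j : 'I_n) := (i != j) && `[< delaunay C S (p i) (p j) >].
have e_sym : symmetric e.
  move=> i j; rewrite /e eq_sym; congr (_ && _); apply/asboolP/asboolP.
    by move=> [al [be [h1 h2 h3 h4]]]; exists al, be; split=> // s sS /(h4 _ sS)[]; [right|left].
  by move=> [al [be [h1 h2 h3 h4]]]; exists al, be; split=> // s sS /(h4 _ sS)[]; [right|left].
have [m [A [U [mmax _ UA cU sep]]]] := tutte_berge e_sym finset.setT.
have {UA}UA i : i \in U -> i \notin A.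
  by move/(fintype.subsetP UA); rewrite !inE andbT.
have eU : size [seq p i | i <- enum U] = #|U| by rewrite size_map -cardE.
have eA : size [seq p i | i <- enum A] = #|A| by rewrite size_map -cardE.
have mem_p (B : {set 'I_n}) i : (p i \in [seq p i | i <- enum B]) = (i \in B).
  by rewrite mem_map // mem_enum.
have bound : (#|U| <= 2 * #|A| + 8)%N.
  rewrite -eU -eA; apply: separated_size.
  - by rewrite map_inj_uniq // enum_uniq.
  - by move=> t /mapP[i]; rewrite mem_enum => iU ->; rewrite mem_p UA.
  move=> t u al be /mapP[i + ->] /mapP[j + ->]; rewrite !mem_enum => iU jU ij al0 Ci Cj.
  have ij' : i != j by apply: contra_neq ij => ->.
  have [X [iX jX Xcl]] := sep _ _ iU jU ij'.
  (* A homothet that avoids [A] and meets both [X] and its complement would yield an edge leaving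
     [X] outside [A]. *)
  apply: contrapT => noA.
  have notA k : C (aff al be (p k)) -> k \in finset.setT :\: A.
    move=> Ck; rewrite !inE andbT; apply/negP => kA; apply: noA.
    by exists (p k); rewrite ?mem_p.
  have [||s1 [s2 [s1S s2S]]] := @delaunay_bichromatic _ _ Cscb S
    (fun z => z \in [seq p i | i <- enum X]) al be (p i) (p j) (pS i) (pS j) _ _ al0 Ci Cj.
  - by rewrite mem_p.
  - by rewrite mem_p.
  have [k ->] := pP _ s1S; have [l ->] := pP _ s2S.
  rewrite !mem_p => kX lX [Ck Cl kl].
  have kl' : k != l by apply: contraNneq lX => <-.
  case/negP: lX; apply: (Xcl k l (notA _ Ck) (notA _ Cl) kX).
  by rewrite /e kl'; apply/asboolP.
have cUA : (#|U| + #|A| <= n)%N.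
  rewrite -[X in (_ <= X)%N]card_ord -(cardsC A) addnC leq_add2l; apply: subset_leq_card.
  by apply/fintype.subsetP => i /UA; rewrite inE.
have [mM _] := mmax.
have [mK me _] := matchingP _ _ _ mM.
pose B : {set 'I_n} := [set i : 'I_n in finset.setT | (i <= m i)%N]%SET.
have cB : ((#|B|).*2 = n + #|unmatched finset.setT m|)%N.
  by have := card_matching_reps (@ord_inj n) mM; rewrite cardsT card_ord.
exists #|B|, (fun k => p (enum_val k)), (fun k => p (m (enum_val k))); split.
(* With [d] unmatched points, [2 * K = n + d] and [d <= #|U| - #|A|]; adding [#|U| + #|A| <= n] to
   twice [bound] gives [3 * d <= n + 16]. *)
- by rewrite -/n; lia.
- move=> s /pP[i ->]; have [im|/ltnW mi] := leqP i (m i).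
    have iB : i \in B by rewrite !inE.
    by exists (enum_rank_in iB i); left; rewrite enum_rankK_in.
  have iB : m i \in B by rewrite !inE mK.
  by exists (enum_rank_in iB (m i)); right; rewrite enum_rankK_in // mK.
move=> k; set i := enum_val k; have [mi|mi] := eqVneq (m i) i.
  have [al [be [h1 h2 h3]]] := isolating_homothet Cscb S (p i).
  by exists al, be; rewrite mi; split=> // s sS /(h3 _ sS); left.
by have /andP[_ /asboolP] := me _ mi.
Qed.
End Independent.

(** * From pairs to the covering number *)

Section Covering.
Variables (R : realType) (C : set (R * R)).
Implicit Types (S : seq (R * R)).

Lemma homothet_aff al be z : 0 < al ->
  homothet C al^-1 (- be.1 / al, - be.2 / al) z <-> C (aff al be z).
Proof.
move=> al0; have aln := lt0r_neq0 al0; split=> [[c Cc <-]|Cz].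
  suff -> : aff al be (al^-1 * c.1 + - be.1 / al, al^-1 * c.2 + - be.2 / al) = c by [].
  by apply: pt_eq; rewrite /=; field.
exists (aff al be z) => //.
by apply: pt_eq; rewrite /=; field.
Qed.

Lemma fcov_le k S K : coverable C k S K -> (fcov C k S <= K)%N.
Proof.
move=> cov; rewrite /fcov; case: pselect => [h|//].
by case: ex_minnP => j _; apply; apply/asboolP.
Qed.

Lemma fcov_pairs_le S K (p1 p2 : 'I_K -> R * R) : uniq S ->
  (forall s, s \in S -> exists i, s = p1 i \/ s = p2 i) ->
  (forall i, exists al be, [/\ 0 < al, C (aff al be (p1 i)),
     C (aff al be (p2 i)) &
     forall s, s \in S -> C (aff al be s) -> s = p1 i \/ s = p2 i]) ->
  (fcov C 2 S <= K)%N.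
Proof.
move=> Suniq cov pairs; apply: fcov_le.
have [al /choice[be h]] := choice pairs.
exists (fun i => (al i)^-1), (fun i => (- (be i).1 / al i, - (be i).2 / al i)).
split=> [i|i|s sS]; have alp i' : 0 < al i' by case: (h i').
- by rewrite invr_gt0.
- rewrite /npts -size_filter.
  apply: (@leq_trans (size [:: p1 i; p2 i])) => //.
  apply: uniq_leq_size; first exact: filter_uniq.
  move=> s; rewrite mem_filter => /andP[/asboolP/(homothet_aff _ _ (alp i)) Cs sS].
  by have [_ _ _ /(_ _ sS Cs)[->|->]] := h i; rewrite !inE eqxx ?orbT.
have [i si] := cov _ sS; exists i; apply/homothet_aff => //.
by have [_ C1 C2 _] := h i; case: si => ->.
Qed.
End Covering.

Unset Implicit Arguments.

Theorem mainTheorem13 (R : realType) (C : set (R * R)) :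
  strictly_convex_body C ->
  forall S : seq (R * R), uniq S ->
    ((fcov C 2 S)%:Z <= (size S)%:Z - Num.ceil (((size S)%:R - 8) / 3 : R))%R.
Proof.
move=> Cscb S Suniq.
have [K [p1 [p2 [bound cov pairs]]]] := separated_pairing Cscb Suniq.
have := fcov_pairs_le Suniq cov pairs; set n := size S in bound * => le.
(* The bound [3 * K <= 2 * n + 8] says that [(n - 8) / 3 <= n - K], and the right side is an
   integer. *)
have : (Num.ceil ((n%:R - 8) / 3 : R) <= n%:Z - K%:Z)%R.
  rewrite ceil_le_int ler_pdivrMr // intrB -!pmulrn lerBlDr.
  have : (3 * K)%:R <= (2 * n + 8)%:R :> R by rewrite ler_nat; lia.
  by rewrite natrM natrD natrM; lra.
by lia.
Qed.
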